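(* Let $\mathcal{A}_n$ be one of the families $\mathcal{M}_n$ (meanders), $\mathcal{E}_n$ (excursions), $\mathcal{W}_n(h,r,s)$ (paths with a wall), $\mathcal{C}_n$ (culminating paths), assumed non-empty. The Coupling From The Past algorithm for the flip chain on $\mathcal{A}_n$ with weights $$p_i=i(2n-i)\kappa_0+\frac{1}{4n^2}\quad(1\le i\le n),\qquad \kappa_0=\frac{3}{2n^2(n+1)},$$ ends with probability $1$ and returns an exact sample of the uniform distribution over $\mathcal{A}_n$. For the families $\mathcal{W}_n(h,r,s)$, $\mathcal{E}_n$, $\mathcal{M}_n$, this takes on average $\mathcal{O}(n^3(\log n)^2)$ time units.
   Context: Paths. Fix integers $n,a,b>0$. A path of length $n$ is a word $\mathbf{S}=(s_1,\dots,s_n)\in\{a,-b\}^n$, identified with its heights $S_i=s_1+\dots+s_i$, $1\le i\le n$, and $S_0=0$. Families. $\mathcal{M}_n$: paths with $S_i\ge 0$ for all $i\le n$. $\mathcal{E}_n$: paths with $S_i\ge 0$ for all $i\le n$ and $S_n=0$. $\mathcal{W}_n(h,r,s)$, for given integers $h$ and $1\le r\le s\le n$: paths with $S_i\ge h$ for all $r\le i\le s$. $\mathcal{C}_n$: paths with $0\le S_i\le S_n$ for all $i\le n$; for this family $n\ge\lceil b/a\rceil+1$ is assumed. Flips. For $i\in\{1,\dots,n\}$, $\varepsilon\in\{\uparrow,\downarrow\}$, $\delta\in\{+,-\}$ define $\phi(\mathbf{S},i,\varepsilon,\delta)\in\{a,-b\}^n$ as follows. If $i<n$: $\phi(\mathbf{S},i,\uparrow,\delta)$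 is obtained by replacing $(s_i,s_{i+1})$ by $(a,-b)$ if $(s_i,s_{i+1})=(-b,a)$, and equals $\mathbf{S}$ otherwise; $\phi(\mathbf{S},i,\downarrow,\delta)$ is obtained by replacing $(s_i,s_{i+1})$ by $(-b,a)$ if $(s_i,s_{i+1})=(a,-b)$, and equals $\mathbf{S}$ otherwise. If $i=n$ and the family is $\mathcal{M}_n$, $\mathcal{E}_n$ or $\mathcal{W}_n(h,r,s)$: apply the same rule as if there were an additional letter $s_{n+1}=a$ (when $\delta=+$) or $s_{n+1}=-b$ (when $\delta=-$), and keep the first $n$ letters; thus $\phi(\mathbf{S},n,\uparrow,+)$ changes $s_n=-b$ into $a$, $\phi(\mathbf{S},n,\downarrow,-)$ changes $s_n=a$ into $-b$, and in all other cases with $i=n$ the path is unchanged. If $i=n$ and the family is $\mathcal{C}_n$: $\phi(\mathbf{S},n,\uparrow,\delta)$ (resp. $\phi(\mathbf{S},n,\downarrow,\delta)$) is obtained by replacing the last $\lceil b/a\rceil+1$ steps of $\mathbf{S}$ by $(a,a,\dots,a)$ (resp. by $(-b,a,\dots,a)$), for either value of $\delta$. Update. Given $(i,\varepsilon,\delta)$, the update of $\mathbf{S}\in\mathcal{A}_n$ is $\phi(\mathbf{S},i,\varepsilon,\delta)$ if this path is in $\mathcal{A}_n$, and $\mathbf{S}$ otherwise. One step of the flip chain with weights $(p_i)$ applies the update with independent $I$, $\varepsilon$, $\delta$, where $\mathbb{P}(I=i)=p_i$ and $\varepsilon$, $\delta$ are uniform in $\{\uparrow,\downarrow\}$ and $\{+,-\}$.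 Order. $\mathbf{S}\preceq\mathbf{T}$ iff $S_i\le T_i$ for all $i$; $\hat 0$ and $\hat 1$ denote the smallest and largest elements of $\mathcal{A}_n$ for $\preceq$. Coupling From The Past algorithm. Let $(I_t,\varepsilon_t,\delta_t)_{t\le -1}$ be i.i.d. with the law of $(I,\varepsilon,\delta)$ above. Start with $\tau=1$. Repeat: set $\mathbf{S}=\hat 0$, $\mathbf{T}=\hat 1$; for $t=-\tau,-\tau+1,\dots,-1$ successively, apply to both $\mathbf{S}$ and $\mathbf{T}$ the update with the same $(I_t,\varepsilon_t,\delta_t)$; if $\mathbf{S}=\mathbf{T}$ stop and return this path, otherwise replace $\tau$ by $2\tau$ and repeat, reusing the same random variables $(I_t,\varepsilon_t,\delta_t)$ for the times already considered. Time units: drawing a random variable, and testing and performing one update, each cost $\mathcal{O}(1)$ time units for the families $\mathcal{W}_n$, $\mathcal{E}_n$, $\mathcal{M}_n$. *)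

(* Defs.v *)
(* MathComp / MathComp-Analysis. *)
From mathcomp Require Import all_boot all_order all_algebra.
From mathcomp Require Import all_classical all_reals all_analysis.

Set Implicit Arguments.
Unset Strict Implicit.
Unset Printing Implicit Defensive.

Import Order.TTheory GRing.Theory Num.Theory.

Local Open Scope classical_set_scope.
Local Open Scope ring_scope.

(* A letter is a boolean: [true] stands for the step a, [false] for -b.  The
   letter s_i (1 <= i <= n) of the path S is S (i - 1): ordinals start at 0. *)
Notation walk n := {ffun 'I_n -> bool}.

Definition height (a b n : nat) (S : walk n) (i : nat) : int :=
  \sum_(j < n | (j < i)%N) (if S j then a%:Z else - b%:Z).

Inductive path_family : Type :=
  | Meander
  | Excursion
  | Wall of int & nat & nat
  | Culminating.

Definition is_culminating (F : path_family) : bool :=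
  if F is Culminating then true else false.

(* The ceiling of b / a, for a > 0. *)
Definition ceil_ratio (a b : nat) : nat := ((b + a.-1) %/ a)%N.

Definition wf_family (a b n : nat) (F : path_family) : bool :=
  match F with
  | Meander | Excursion => true
  | Wall _ r s => [&& 1 <= r, r <= s & s <= n]%N
  | Culminating => (ceil_ratio a b + 1 <= n)%N
  end.

Definition paths_of (a b n : nat) (F : path_family) : {set walk n} :=
  match F with
  | Meander => [set S : walk n | [forall i : 'I_n.+1, 0 <= height a b S i]]
  | Excursion =>
      [set S : walk n | [forall i : 'I_n.+1, 0 <= height a b S i]
                        && (height a b S n == 0)]
  | Wall h r s =>
      [set S : walk n | [forall i : 'I_n.+1,
                          (r <= i <= s)%N ==> (h <= height a b S i)]]
  | Culminating =>
      [set S : walk n | [forall i : 'I_n.+1,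
                          0 <= height a b S i <= height a b S n]]
  end%SET.

(* A triple (i, eps, delta): the ordinal i encodes the position i + 1, eps is
   [true] for an up flip, and delta is the optional letter s_(n+1), namely
   [true] (= a) for + and [false] (= -b) for -. *)
Notation move n := ('I_n * bool * bool)%type.

(* The letter of 0-based index k of S followed by the additional letter. *)
Definition letter (n : nat) (S : walk n) (delta : bool) (k : nat) : bool :=
  if insub k is Some j then S j else delta.

(* With the boolean encoding, an up flip turns (false, true) into (true, false)
   and a down flip does the opposite: in both cases (~~ eps, eps) becomes
   (eps, ~~ eps). *)
Definition flip_local (n : nat) (S : walk n) (m : move n) : walk n :=
  let: (i, eps, delta) := m in
  if (S i == ~~ eps) && (letter S delta i.+1 == eps) then
    [ffun j : 'I_n => if j == i then eps
                      else if (j == i.+1 :> nat) then ~~ eps else S j]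
  else S.

(* The last c + 1 letters are replaced by (a, a, ..., a) if eps is [true] and by
   (-b, a, ..., a) if eps is [false]. *)
Definition flip_end (c n : nat) (S : walk n) (eps : bool) : walk n :=
  [ffun j : 'I_n => if (j < n - c.+1)%N then S j
                    else if (j == n - c.+1 :> nat)%N then eps else true].

Definition flip (a b n : nat) (F : path_family) (S : walk n) (m : move n) : walk n :=
  let: (i, eps, delta) := m in
  if is_culminating F && (i.+1 == n) then flip_end (ceil_ratio a b) S eps
  else flip_local S m.

Definition update (a b n : nat) (F : path_family) (S : walk n) (m : move n) :
    walk n :=
  if flip a b F S m \in paths_of a b n F then flip a b F S m else S.

Definition path_le (a b n : nat) (S T : walk n) : bool :=
  [forall i : 'I_n.+1, height a b S i <= height a b T i].

(* The default value of [odflt] is taken only if the family has no smallest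
   (resp. largest) element. *)
Definition hat0 (a b n : nat) (F : path_family) : walk n :=
  odflt [ffun => false]
    [pick S in paths_of a b n F |
      [forall T in paths_of a b n F, path_le a b S T]].

Definition hat1 (a b n : nat) (F : path_family) : walk n :=
  odflt [ffun => true]
    [pick S in paths_of a b n F |
      [forall T in paths_of a b n F, path_le a b T S]].

(* The moves of the past are given by x : nat -> move n, where x k is the move
   of time -(k + 1).  [evolve x tau S] applies to S the moves of the times
   -tau, ..., -1 in this order. *)
Fixpoint evolve (a b n : nat) (F : path_family) (x : nat -> move n) (tau : nat)
    (S : walk n) : walk n :=
  if tau is k.+1 then evolve a b F x k (update a b F S (x k)) else S.

(* Apart from tau and the returned path (if any), the state of the algorithm
   records how many of the triples (I_t, eps_t, delta_t) have been drawn and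
   how many updates have been performed so far. *)
Record cftp_state (n : nat) : Type := CftpState {
  cftp_tau : nat;
  cftp_drawn : nat;
  cftp_updates : nat;
  cftp_result : option (walk n)
}.

(* One round: tau updates of each of the two paths.  Only the triples of the
   times not considered before are drawn. *)
Definition cftp_round (a b n : nat) (F : path_family) (x : nat -> move n)
    (st : cftp_state n) : cftp_state n :=
  if cftp_result st is Some _ then st else
  let tau := cftp_tau st in
  let S := evolve a b F x tau (hat0 a b n F) in
  let T := evolve a b F x tau (hat1 a b n F) in
  let drawn := maxn (cftp_drawn st) tau in
  let updates := (cftp_updates st + 2 * tau)%N in
  if S == T then CftpState tau drawn updates (Some S)
  else CftpState (2 * tau)%N drawn updates None.

(* The state after at most k rounds. *)
Definition cftp (a b n : nat) (F : path_family) (x : nat -> move n) (k : nat) :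
    cftp_state n :=
  iter k (cftp_round a b F x) (CftpState 1 0 0 None).

Definition cftp_returns (a b n : nat) (F : path_family) (x : nat -> move n)
    (S : walk n) : Prop :=
  exists k : nat, cftp_result (cftp a b F x k) = Some S.

(* Total running time when drawing one random variable costs cdraw and testing
   and performing one update costs cupd; each triple consists of three random
   variables.  It is +oo when the algorithm does not stop (if cupd > 0). *)
Definition cftp_time (R : realType) (cdraw cupd : R) (a b n : nat) (F : path_family)
    (x : nat -> move n) : \bar R :=
  ereal_sup (range (fun k : nat =>
    (cdraw * (3 * cftp_drawn (cftp a b F x k))%N%:R
     + cupd * (cftp_updates (cftp a b F x k))%:R)%:E)).

Definition weight (R : realType) (n i : nat) : R :=
  let kappa0 : R := 3 / (2 * n%:R ^+ 2 * (n%:R + 1)) in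
  i%:R * (2 * n%:R - i%:R) * kappa0 + 1 / (4 * n%:R ^+ 2).

(* Law of (I, eps, delta) for independent I, eps, delta with eps and delta
   uniform on two values. *)
Definition move_law (R : realType) (n : nat) (m : move n) : R :=
  let: (i, _, _) := m in weight R n i.+1 * (1 / 2) * (1 / 2).

(* V carries the discrete sigma-algebra: all its subsets are measurable. *)
Definition mutually_independent (R : realType) (d : measure_display)
    (Omega : measurableType d) (P : probability Omega R) (V : Type)
    (X : nat -> Omega -> V) : Prop :=
  forall (J : seq nat) (B : nat -> set V), uniq J ->
    P (\bigcap_(k in [set` J]) (X k @^-1` B k))
    = (\prod_(k <- J) P (X k @^-1` B k))%E.

Definition iid_moves (R : realType) (d : measure_display)
    (Omega : measurableType d) (P : probability Omega R) (n : nat)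
    (X : nat -> Omega -> move n) : Prop :=
  [/\ forall (k : nat) (B : set (move n)), measurable (X k @^-1` B),
      forall (k : nat) (m : move n),
        P (X k @^-1` [set m]) = (move_law R m)%:E
    & mutually_independent P X].

(* Main.v *)
(* The height of S at time k is (a + b) u - b k, where u = ups S k counts the up
   steps, so the order on paths is the order on the counting functions ups.  Each
   family is stable under pointwise minimum and maximum (hence has a smallest
   and a largest element), the updates are monotone, the transition matrix is
   symmetric, and every non-maximal path has an update which raises it.  So the
   two coupled paths merge with a probability bounded below in every block of
   n^2 + 1 steps.  Once they have merged after t steps of the past, every
   starting point leads to the returned path, whose law is within
   P(not merged) of the average over the starting points of the t-step law,
   i.e. of the uniform law.

   For the running time, let D k be the difference of ups at time k between
   the upper and the lower path.  Away from the constraints the mean change of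
   D k is p_k / 2 times the discrete Laplacian of D, and the constraints only
   decrease it.  Summing by parts, the total gap \sum_k D k contracts in mean by
   the factor 1 - kappa0 / 2, since p_{i-1} - 2 p_i + p_{i+1} = -2 kappa0.
   Hence P(not merged after t steps) <= n^2 exp(- t / (4 n^3)), which makes the
   expected time O(n^3 log n). *)
Require Import Defs.
From mathcomp Require Import all_boot all_order all_algebra.
From mathcomp Require Import all_classical all_reals all_analysis measurable_realfun.
From mathcomp Require Import zify ring lra.

Set Implicit Arguments.
Unset Strict Implicit.
Unset Printing Implicit Defensive.

Import Order.TTheory GRing.Theory Num.Theory.
Import numFieldNormedType.Exports.

Local Open Scope classical_set_scope.
Local Open Scope ring_scope.

(** * Lattice structure of the families *)

(** [d] stands for the optional letter after the last step, so that a flip at position n is read,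
    like any other, off three consecutive counts. Up to time n the count is independent of [d], and
    [false] serves as default. *)
Definition ups (n : nat) (S : walk n) (d : bool) (k : nat) : nat :=
  (\sum_(j < k) letter S d j)%N.

Lemma letter_lt n (S : walk n) d k (hk : (k < n)%N) :
  letter S d k = S (Ordinal hk).
Proof. by rewrite /letter insubT. Qed.

Lemma letter_ord n (S : walk n) d (i : 'I_n) : letter S d i = S i.
Proof. by rewrite (letter_lt _ _ (ltn_ord i)); congr (S _); apply: val_inj. Qed.

Lemma letter_ge n (S : walk n) d k : (n <= k)%N -> letter S d k = d.
Proof. by move=> hk; rewrite /letter insubF // ltnNge hk. Qed.

Lemma ups0 n (S : walk n) d : ups S d 0 = 0%N.
Proof. by rewrite /ups big_ord0. Qed.

Lemma upsS n (S : walk n) d k : ups S d k.+1 = (ups S d k + letter S d k)%N.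
Proof. by rewrite /ups big_ord_recr. Qed.

Lemma ups_delta n (S : walk n) d d' k :
  (k <= n)%N -> ups S d k = ups S d' k.
Proof.
move=> hk; apply: eq_bigr => j _; have hj := leq_trans (ltn_ord j) hk.
by rewrite !(letter_lt _ _ hj).
Qed.

Lemma ups_step n (S : walk n) d k : (ups S d k <= ups S d k.+1 <= (ups S d k).+1)%N.
Proof. by rewrite upsS; case: letter; lia. Qed.

Lemma ups_le n (S : walk n) d k : (ups S d k <= k)%N.
Proof. by elim: k => [|k IH]; rewrite ?ups0 // upsS; case: letter; lia. Qed.

Lemma ups_inj n (S T : walk n) :
  (forall k, (k <= n)%N -> ups S false k = ups T false k) -> S = T.
Proof.
move=> h; apply/ffunP => i; have hi := ltn_ord i.
have := h _ hi; rewrite !upsS h ?letter_ord; last exact: ltnW.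
by case: (S i); case: (T i); lia.
Qed.

Lemma heightE a b n (S : walk n) k : (k <= n)%N ->
  height a b S k = (a + b)%:Z * (ups S false k)%:Z - b%:Z * k%:Z.
Proof.
elim: k => [|k IH] hk; first by rewrite /height big_pred0 ?ups0 ?mulr0.
rewrite /height (bigD1 (Ordinal hk)) //=.
rewrite (eq_bigl (fun j : 'I_n => (j < k)%N)); last first.
  by move=> j; rewrite -val_eqE /=; lia.
rewrite -/(height a b S k) IH; last exact: ltnW.
by rewrite upsS (letter_lt _ _ hk); case: (S _); lia.
Qed.

Definition walk_of (n : nat) (u : nat -> nat) : walk n :=
  [ffun j : 'I_n => (u j < u j.+1)%N].

Lemma ups_walk_of n u d k : u 0%N = 0%N ->
  (forall j, (j < n)%N -> (u j <= u j.+1 <= (u j).+1)%N) ->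
  (k <= n)%N -> ups (walk_of n u) d k = u k.
Proof.
move=> u0 hu; elim: k => [|k IH] hk; first by rewrite ups0 u0.
rewrite upsS IH; last exact: ltnW.
by rewrite (letter_lt _ _ hk) ffunE /=; have := hu _ hk; lia.
Qed.

Definition leW n (S T : walk n) := forall k, (k <= n)%N ->
  (ups S false k <= ups T false k)%N.

Lemma leW_anti n (S T : walk n) : leW S T -> leW T S -> S = T.
Proof. by move=> h1 h2; apply: ups_inj => k hk; have := h1 k hk; have := h2 k hk; lia. Qed.

Lemma leW_delta n (S T : walk n) d k : leW S T -> (k <= n.+1)%N ->
  (ups S d k <= ups T d k)%N.
Proof.
move=> h hk; have [hkn|] := leqP k n.
  by rewrite !(ups_delta _ _ false) //; apply: h.
move=> hnk; have -> : k = n.+1 by lia.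
rewrite !upsS !letter_ge // leq_add2r !(ups_delta _ _ false) //; exact: h.
Qed.

Lemma height_le a b n (S T : walk n) k : (0 < a)%N -> (k <= n)%N ->
  (height a b S k <= height a b T k) = (ups S false k <= ups T false k)%N.
Proof. by move=> ha hk; rewrite !heightE //; nia. Qed.

Lemma path_leW a b n (S T : walk n) : (0 < a)%N ->
  reflect (leW S T) (Defs.path_le a b S T).
Proof.
move=> ha; apply: (iffP forallP) => [h k hk|h k].
  have := h (Ordinal (hk : (k < n.+1)%N)); by rewrite height_le.
by rewrite height_le ?h // -ltnS.
Qed.

(** A strictly increasing potential for [leW]: extremal paths are found by optimizing it, climbing
    is measured by it, and the gap of two coupled paths is a difference of areas. *)
Definition area n (S : walk n) := (\sum_(k < n.+1) ups S false k)%N.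

Lemma area_le n (S T : walk n) : leW S T -> (area S <= area T)%N.
Proof. by move=> h; apply: leq_sum => k _; apply: h; rewrite -ltnS. Qed.

Lemma area_ge_eq n (S T : walk n) : leW S T -> (area T <= area S)%N -> S = T.
Proof.
move=> h hA; apply: ups_inj => k hk.
have: (area T - area S = 0)%N by lia.
rewrite /area -sumnB; last by move=> j _; apply: h; rewrite -ltnS.
move/eqP; rewrite sum_nat_eq0 => /forallP /(_ (Ordinal (hk : (k < n.+1)%N))) /=.
have := h k hk; lia.
Qed.

Lemma area_bound n (S : walk n) : (area S <= n * n)%N.
Proof.
rewrite /area big_ord_recl ups0 add0n.
apply: leq_trans (_ : \sum_(i < n) n <= _)%N; last by rewrite sum_nat_const card_ord.
by apply: leq_sum => k _; apply: leq_trans (ups_le _ _ _) _; rewrite lift0; exact: ltn_ord.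
Qed.

(* The condition imposed at time k on u = ups S k by the families that constrain
   each height separately; vacuous for culminating paths, whose constraint
   involves the final height. *)
Definition box_ok (a b n : nat) (F : path_family) (k u : nat) : bool :=
  let h : int := (a + b)%:Z * u%:Z - b%:Z * k%:Z in
  match F with
  | Meander => 0 <= h
  | Excursion => (0 <= h) && ((k == n) ==> (h == 0))
  | Wall h0 r s => (r <= k <= s)%N ==> (h0 <= h)
  | Culminating => true
  end.

(** At a fixed time the height is affine and nondecreasing in u, so the constraint cuts out an
    interval of counts. *)
Lemma box_convex a b n F k u v w : (u <= v <= w)%N ->
  box_ok a b n F k u -> box_ok a b n F k w -> box_ok a b n F k v.
Proof.
move=> huvw; case: F => [||h r s|] //=.
- by nia.
- by case: eqP => _ /=; nia.
- by case: (r <= k <= s)%N => //=; nia.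
Qed.

Lemma mem_box a b n F (S : walk n) : ~~ is_culminating F ->
  reflect (forall k, (k <= n)%N -> box_ok a b n F k (ups S false k))
    (S \in paths_of a b n F).
Proof.
case: F => [||h r s|] // _; rewrite inE; apply: (iffP idP).
- by move=> /forallP h k hk; have := h (Ordinal (hk : (k < n.+1)%N)); rewrite heightE.
- by move=> h; apply/forallP => k; have hk : (k <= n)%N := ltn_ord k; rewrite heightE //; apply: h.
- move=> /andP[/forallP h h0] k hk; have := h (Ordinal (hk : (k < n.+1)%N)).
  by rewrite /= !heightE // => ->/=; apply/implyP => /eqP ->; rewrite -heightE.
- move=> h; apply/andP; split; last by have := h n (leqnn n); rewrite /= eqxx heightE // => /andP[].
  apply/forallP => k; have hk : (k <= n)%N := ltn_ord k.
  by rewrite heightE //; have /andP[] := h k hk.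
- by move=> /forallP h' k hk; have := h' (Ordinal (hk : (k < n.+1)%N)); rewrite heightE.
- move=> h'; apply/forallP => k; have hk : (k <= n)%N := ltn_ord k.
  by rewrite heightE //; apply: h'.
Qed.

Lemma mem_culm a b n (S : walk n) :
  reflect (forall k, (k <= n)%N -> 0 <= height a b S k <= height a b S n)
    (S \in paths_of a b n Culminating).
Proof.
rewrite inE; apply: (iffP forallP) => [h k hk|h k].
  exact: (h (Ordinal (hk : (k < n.+1)%N))).
by apply: h; rewrite -ltnS.
Qed.

Definition meetW n (S T : walk n) : walk n :=
  walk_of n (fun k => minn (ups S false k) (ups T false k)).

Definition joinW n (S T : walk n) : walk n :=
  walk_of n (fun k => maxn (ups S false k) (ups T false k)).

Lemma ups_meet n (S T : walk n) d k : (k <= n)%N ->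
  ups (meetW S T) d k = minn (ups S false k) (ups T false k).
Proof.
move=> hk; rewrite ups_walk_of ?ups0 // => j hj.
by have := ups_step S false j; have := ups_step T false j; lia.
Qed.

Lemma ups_join n (S T : walk n) d k : (k <= n)%N ->
  ups (joinW S T) d k = maxn (ups S false k) (ups T false k).
Proof.
move=> hk; rewrite ups_walk_of ?ups0 // => j hj.
by have := ups_step S false j; have := ups_step T false j; lia.
Qed.

Lemma meet_mem a b n F (S T : walk n) : S \in paths_of a b n F ->
  T \in paths_of a b n F -> meetW S T \in paths_of a b n F.
Proof.
case hF: (is_culminating F).
  case: F hF => // _ /mem_culm hS /mem_culm hT; apply/mem_culm => k hk.
  (* The path with the lower end point stays below it, hence so does the minimum at time k. *)
  have := hS k hk; have := hT k hk; rewrite !heightE // !ups_meet //; nia.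
have {}hF := negbT hF.
move=> /(mem_box _ _ _ hF) hS /(mem_box _ _ _ hF) hT; apply/(mem_box _ _ _ hF) => k hk.
by rewrite ups_meet // /minn; case: ifP => _; [apply: hS | apply: hT].
Qed.

Lemma join_mem a b n F (S T : walk n) : S \in paths_of a b n F ->
  T \in paths_of a b n F -> joinW S T \in paths_of a b n F.
Proof.
case hF: (is_culminating F).
  case: F hF => // _ /mem_culm hS /mem_culm hT; apply/mem_culm => k hk.
  have := hS k hk; have := hT k hk; rewrite !heightE // !ups_join //; nia.
have {}hF := negbT hF.
move=> /(mem_box _ _ _ hF) hS /(mem_box _ _ _ hF) hT; apply/(mem_box _ _ _ hF) => k hk.
by rewrite ups_join // /maxn; case: ifP => _; [apply: hT | apply: hS].
Qed.

(** A member of least area lies below every T: its meet with T is again a member, of no smaller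
    area, hence equal to it. So the default of [odflt] is never taken. *)
Lemma hat0P a b n F : (0 < a)%N -> paths_of a b n F != finset.set0 ->
  hat0 a b n F \in paths_of a b n F /\
  forall T, T \in paths_of a b n F -> leW (hat0 a b n F) T.
Proof.
move=> ha /set0Pn[S0 hS0]; rewrite /hat0.
case: pickP => [S /andP[hS /forallP hmin]|hno] /=.
  by split=> // T hT; apply/(path_leW b _ _ ha); have := hmin T; rewrite hT.
exfalso; case: (arg_minnP (@area n) hS0) => S hS hmin.
have := hno S; rewrite /= (hS : S \in _) /= => /negP; apply; apply/forallP => T; apply/implyP => hT.
apply/path_leW => //; have hM := meet_mem hS hT.
have -> : S = meetW S T.
  symmetry; apply: area_ge_eq (hmin _ hM) => k hk.
  by rewrite ups_meet // geq_minl.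
by move=> k hk; rewrite ups_meet // geq_minr.
Qed.

Lemma hat1P a b n F : (0 < a)%N -> paths_of a b n F != finset.set0 ->
  hat1 a b n F \in paths_of a b n F /\
  forall T, T \in paths_of a b n F -> leW T (hat1 a b n F).
Proof.
move=> ha /set0Pn[S0 hS0]; rewrite /hat1.
case: pickP => [S /andP[hS /forallP hmax]|hno] /=.
  by split=> // T hT; apply/(path_leW b _ _ ha); have := hmax T; rewrite hT.
exfalso; case: (arg_maxnP (@area n) hS0) => S hS hmax.
have := hno S; rewrite /= (hS : S \in _) /= => /negP; apply; apply/forallP => T; apply/implyP => hT.
apply/path_leW => //; have hM := join_mem hS hT.
have -> : S = joinW S T.
  apply: area_ge_eq (hmax _ hM) => k hk.
  by rewrite ups_join // leq_maxl.
by move=> k hk; rewrite ups_join // leq_maxr.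
Qed.

(** * Local flips *)

Definition flippable n (S : walk n) (m : move n) : bool :=
  let: (i, e, d) := m in (S i == ~~ e) && (letter S d i.+1 == e).

Lemma flippable_ups n (S : walk n) i e d :
  flippable S (i, e, d) =
  if e then (ups S d i.+1 == ups S d i) && (ups S d i.+2 == (ups S d i.+1).+1)
  else (ups S d i.+1 == (ups S d i).+1) && (ups S d i.+2 == ups S d i.+1).
Proof.
rewrite /flippable (upsS S d i.+1) (upsS S d i) letter_ord.
by case: e; case: (S i); case: (letter _ _ _) => /=; lia.
Qed.

Lemma flip_localE n (S : walk n) m :
  ~~ flippable S m -> flip_local S m = S.
Proof. by case: m => [[i e] d]; rewrite /flippable /flip_local => /negbTE ->. Qed.

Lemma letter_flip n (S : walk n) i e d k : flippable S (i, e, d) ->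
  (k < n)%N -> letter (flip_local S (i, e, d)) false k =
    if k == i then e else if k == i.+1 then ~~ e else letter S false k.
Proof.
move=> hf hk; rewrite !(letter_lt _ _ hk) /flip_local.
by rewrite /flippable in hf; rewrite hf ffunE -val_eqE.
Qed.

(** Only the count at time i + 1 changes, by one. Corrections stand on both sides to avoid truncated
    subtraction. *)
Lemma ups_flip n (S : walk n) i e d k : flippable S (i, e, d) -> (k <= n)%N ->
  (ups (flip_local S (i, e, d)) false k + (k == i.+1) * ~~ e =
   ups S false k + (k == i.+1) * e)%N.
Proof.
move=> hf; elim: k => [|k IH] hk; first by rewrite !ups0.
have hn : (k <= n)%N := ltnW hk; have {}IH := IH hn.
rewrite !upsS letter_flip //.
have := hf; rewrite /flippable -(letter_ord S false) => /andP[/eqP h1 /eqP h2].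
have [ek|hki] := eqVneq k i; first subst k.
  have hne : (nat_of_ord i == i.+1) = false by lia.
  by move: IH; rewrite h1 !eqxx hne; case: (e); rewrite /= ?addn0 ?mul0n ?mul1n; lia.
have [hk1|hki1] := eqVneq k i.+1.
  move: h2 IH; rewrite hk1 !(letter_lt _ _ (etrans (congr1 (fun x => x < n)%N (esym hk1)) hk)).
  by move=> ->; rewrite eqxx; case: (e) => /=; lia.
have -> : (k.+1 == i.+1) = false by lia.
by move: IH; rewrite (negbTE hki1); lia.
Qed.

Definition ends n (m : move n) : bool := m.1.1.+1 == n.

Definition local_move n (F : path_family) (m : move n) : bool :=
  ~~ (is_culminating F && ends m).

Lemma flip_is_local a b n F (S : walk n) m : local_move F m ->
  flip a b F S m = flip_local S m.
Proof.
by case: m => [[i e] d]; rewrite /local_move /ends /= => /negbTE; rewrite /flip => ->.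
Qed.

(* A local flip before time n does not move the end point, so that also for
   culminating paths it has to satisfy a constraint at a single time. *)
Definition loc_ok (a b n : nat) (F : path_family) (S : walk n) (k u : nat) : bool :=
  if F is Culminating then
    0 <= (a + b)%:Z * u%:Z - b%:Z * k%:Z <= height a b S n
  else box_ok a b n F k u.

Lemma flip_mem a b n F (S : walk n) i e d : local_move F (i, e, d) ->
  S \in paths_of a b n F -> flippable S (i, e, d) ->
  (flip_local S (i, e, d) \in paths_of a b n F) =
  loc_ok a b F S i.+1 (ups (flip_local S (i, e, d)) false i.+1).
Proof.
move=> hl hS hf; set S' := flip_local _ _.
have hi : (i < n)%N := ltn_ord i.
have hu k : (k <= n)%N -> k != i.+1 -> ups S' false k = ups S false k.
  by move=> hk hki; have := ups_flip hf hk; rewrite (negbTE hki) !mul0n !addn0.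
case hF: (is_culminating F).
  case: F hF hl hS => // _; rewrite /local_move /ends /= => hin /mem_culm hS.
  have hn : height a b S' n = height a b S n by rewrite !heightE // hu //; lia.
  apply/mem_culm/idP => [h|h k hk].
    by have := h _ hi; rewrite hn heightE.
  have [->|hki] := eqVneq k i.+1; first by rewrite heightE // hn.
  by have := hS k hk; rewrite hn !(heightE _ _ _ hk) hu.
have {}hF := negbT hF.
have -> : loc_ok a b F S i.+1 (ups S' false i.+1) = box_ok a b n F i.+1 (ups S' false i.+1).
  by case: F hF {hl hS}.
apply/(mem_box _ _ _ hF)/idP => [h|h k hk]; first exact: h.
have [->//|hki] := eqVneq k i.+1.
by rewrite hu //; move/(mem_box _ _ _ hF): hS; apply.
Qed.

Definition accepts a b n F (S : walk n) (m : move n) : bool :=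
  flippable S m && (flip_local S m \in paths_of a b n F).

Lemma update_local a b n F (S : walk n) m : local_move F m ->
  update a b F S m = if accepts a b F S m then flip_local S m else S.
Proof.
move=> hl; rewrite /update flip_is_local // /accepts.
by case hf: (flippable S m) => //=; rewrite flip_localE ?hf // if_same.
Qed.

Lemma ups_update a b n F (S : walk n) i e d k : local_move F (i, e, d) ->
  (k <= n)%N ->
  (ups (update a b F S (i, e, d)) false k
     + ((k == i.+1) && accepts a b F S (i, e, d)) * ~~ e =
   ups S false k + ((k == i.+1) && accepts a b F S (i, e, d)) * e)%N.
Proof.
move=> hl hk; rewrite update_local //; case hA: accepts; last by rewrite !andbF.
by rewrite !andbT; apply: ups_flip => //; case/andP: hA.
Qed.

Lemma update_mem a b n F (S : walk n) m : S \in paths_of a b n F ->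
  update a b F S m \in paths_of a b n F.
Proof. by move=> hS; rewrite /update; case: ifP. Qed.

Lemma acceptsE a b n F (S : walk n) i e d : local_move F (i, e, d) ->
  S \in paths_of a b n F ->
  accepts a b F S (i, e, d) = flippable S (i, e, d) &&
    loc_ok a b F S i.+1 (if e then (ups S false i.+1).+1 else (ups S false i.+1).-1).
Proof.
move=> hl hS; rewrite /accepts; case hf: flippable => //=.
rewrite flip_mem //; have := ups_flip hf (ltn_ord i); rewrite eqxx.
by case: (e) => /= h; congr loc_ok; lia.
Qed.

(** Where the paths touch, the neighbouring counts are squeezed: a valley of the lower path forces
    one of the upper path, and a peak of the upper path one of the lower. For an up flip of a
    culminating path, the final height of T leaves at least as much room as that of S. *)
Lemma accepts_mono a b n F (S T : walk n) i e d : (0 < a)%N ->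
  local_move F (i, e, d) -> S \in paths_of a b n F -> T \in paths_of a b n F ->
  leW S T -> ups S false i.+1 = ups T false i.+1 ->
  if e then accepts a b F S (i, e, d) -> accepts a b F T (i, e, d)
  else accepts a b F T (i, e, d) -> accepts a b F S (i, e, d).
Proof.
move=> ha hl hS hT hle heq; rewrite !acceptsE // !flippable_ups heq.
have hi : (i < n)%N := ltn_ord i.
have heqd : ups S d i.+1 = ups T d i.+1 by rewrite !(ups_delta _ d false).
have h0 : (ups S d i <= ups T d i)%N by apply: leW_delta => //; lia.
have h2 : (ups S d i.+2 <= ups T d i.+2)%N by apply: leW_delta.
have s1 := ups_step T d i; have s2 := ups_step T d i.+1.
have s1' := ups_step S d i; have s2' := ups_step S d i.+1.
case: e hl => hl /andP[hf hok]; apply/andP; split; try (by clear hok; lia).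
- case: F hl hS hT hok => //= hl hS hT /andP[-> /=] h; apply: le_trans h _.
  by rewrite height_le // hle.
(* Nonnegativity is the same condition as for T; the upper bound holds because the flip lowers S. *)
- case: F hl hS hT hok => //= hl /mem_culm hS hT /andP[-> /= _].
  have := hS i.+1 hi; rewrite heightE // heq => /andP[_]; apply: le_trans; nia.
Qed.

(** Both counts move by at most one and in the same direction, so the order is at risk only where
    the paths touch at time i + 1; [accepts_mono] settles that case. *)
Lemma update_mono_local a b n F (S T : walk n) m : (0 < a)%N ->
  local_move F m -> S \in paths_of a b n F -> T \in paths_of a b n F ->
  leW S T -> leW (update a b F S m) (update a b F T m).
Proof.
case: m => [[i e] d] ha hl hS hT hle k hk.
have := ups_update a b S hl hk; have := ups_update a b T hl hk; have := hle k hk.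
have [->|_] := eqVneq k i.+1 => /=; last by clear; lia.
move=> h hT' hS'.
have [heq|hne] := eqVneq (ups S false i.+1) (ups T false i.+1).
  have := accepts_mono ha hl hS hT hle heq; move: hT' hS'.
  by case: (e) => /=; do 2 case: (accepts _ _ _ _ _) => /=; lia.
by move: hT' hS'; case: (e) => /=; do 2 case: (accepts _ _ _ _ _) => /=; lia.
Qed.

(** The extra letter is reversed too, since at position n a local up flip requires + and a down flip
    requires -. *)
Definition rev_move n (m : move n) : move n := (m.1.1, ~~ m.1.2, ~~ m.2).

Lemma update_rev_local a b n F (S : walk n) m : local_move F m ->
  S \in paths_of a b n F -> update a b F S m != S ->
  update a b F (update a b F S m) (rev_move m) = S.
Proof.
move=> hl hS; rewrite update_local //; case hA: accepts; last by rewrite eqxx.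
move=> _; have hl' : local_move F (rev_move m) by case: m hl {hA} => [[]].
have /andP[hf hm] := hA.
rewrite update_local // /accepts.
have hback : flippable (flip_local S m) (rev_move m) /\
    flip_local (flip_local S m) (rev_move m) = S.
  case: m hf {hl hA hm hl'} => [[i e] d] hf; rewrite /rev_move /=.
  have hff : flippable (flip_local S (i, e, d)) (i, ~~ e, ~~ d).
    have := hf; rewrite /flippable /flip_local => hf'; rewrite hf' ffunE eqxx negbK eqxx /=.
    have [hi|hi] := leqP n i.+1.
      by rewrite letter_ge //; move: hf'; rewrite letter_ge // => /andP[_ /eqP ->].
    by rewrite (letter_lt _ _ hi) ffunE -val_eqE /= gtn_eqF // eqxx.
  split=> //.
  apply: ups_inj => k hk; have := ups_flip hf hk; have := ups_flip hff hk.
  by case: (e) => /=; lia.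
by case: hback => -> ->; rewrite hS.
Qed.

(** * End flips of culminating paths *)

(** With the next bound: [ceil_ratio a b] is the least number of up steps that make up for one down
    step. *)
Lemma ceil_ratio_ge a b : (0 < a)%N -> (b <= ceil_ratio a b * a)%N.
Proof. by move=> ha; rewrite /ceil_ratio; lia. Qed.

Lemma ceil_ratio_lt a b : (0 < a)%N -> (0 < b)%N ->
  ((ceil_ratio a b).-1 * a < b)%N.
Proof. by move=> ha hb; rewrite /ceil_ratio; nia. Qed.

Lemma ups_addn n (S : walk n) d i j : (ups S d (i + j) <= ups S d i + j)%N.
Proof.
elim: j => [|j IH]; first by rewrite !addn0.
by rewrite addnS; have := ups_step S d (i + j); lia.
Qed.

Section CulminatingEnd.
Variables (a b n : nat).
Hypotheses (ha : (0 < a)%N) (hb : (0 < b)%N).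
Let c := ceil_ratio a b.
Hypothesis hn : (c.+1 <= n)%N.
Let p := (n - c.+1)%N.
Let A := paths_of a b n Culminating.

Let pn : (p < n)%N. Proof. by rewrite /p; lia. Qed.

Lemma letter_flip_end (S : walk n) e k : (k < n)%N ->
  letter (flip_end c S e) false k =
  if (k < p)%N then letter S false k else if k == p then e else true.
Proof. by move=> hk; rewrite !(letter_lt _ _ hk) /flip_end ffunE. Qed.

Lemma ups_flip_end_lo (S : walk n) e k : (k <= p)%N ->
  ups (flip_end c S e) false k = ups S false k.
Proof.
elim: k => [|k IH] hk; first by rewrite !ups0.
have hkn : (k < n)%N := ltn_trans hk pn.
by rewrite !upsS IH ?letter_flip_end ?hk // ltnW.
Qed.

Lemma ups_flip_end_hi (S : walk n) e k : (p < k <= n)%N ->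
  ups (flip_end c S e) false k = (ups S false p + e + (k - p.+1))%N.
Proof.
elim: k => [|k IH] // /andP[hpk hkn]; rewrite upsS letter_flip_end //.
have [ek|hkp] := eqVneq k p.
  by subst k; rewrite ltnn ups_flip_end_lo //; lia.
have hk : (p < k)%N by rewrite ltn_neqAle eq_sym hkp -ltnS.
by rewrite ltnNge (ltnW hk) /= IH ?hk ?(ltnW hkn) //; lia.
Qed.

(* After an early down step among the last c + 1 ones, the remaining up steps
   are too few to bring the path back to the height it had before. *)
Lemma culm_tail (S : walk n) : S \in A ->
  flip_end c S (letter S false p) = S.
Proof.
move=> hS.
have tail k : (p < k < n)%N -> letter S false k = true.
  move=> /andP[hpk hkn]; apply/negPn/negP => hk.
  have /mem_culm /(_ k (ltnW hkn)) /andP[_] := hS.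
  rewrite !heightE ?(ltnW hkn) //.
  have hu : (ups S false n <= ups S false k.+1 + (n - k.+1))%N.
    by have := ups_addn S false k.+1 (n - k.+1); rewrite subnKC.
  move: hu; rewrite upsS (negbTE hk) addn0 => hu.
  have := ceil_ratio_lt ha hb; rewrite -/c => hc.
  have : (n - k.+1 <= c.-1)%N by rewrite /p in hpk; lia.
  move: hu hc; set x := ups _ _ _; set y := ups _ _ _.
  clear -hkn ha; nia.
apply: ups_inj => k; elim: k => [|k IH] hk; first by rewrite !ups0.
rewrite !upsS IH ?letter_flip_end //; last exact: ltnW.
have [//|hpk] := ltnP k p; have [->//|hkp] := eqVneq k p.
by rewrite tail //; lia.
Qed.

Lemma culm_ups_hi (S : walk n) k : S \in A -> (p < k <= n)%N ->
  ups S false k = (ups S false p + letter S false p + (k - p.+1))%N.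
Proof. by move=> hS hk; rewrite -[in LHS](culm_tail hS) ups_flip_end_hi. Qed.

Lemma ups_flip_end (S : walk n) e k : S \in A -> (p < k <= n)%N ->
  (ups (flip_end c S e) false k + letter S false p = ups S false k + e)%N.
Proof. by move=> hS hk; rewrite ups_flip_end_hi // (culm_ups_hi hS hk); lia. Qed.

(** By [culm_tail] the new path is either S or S lifted by a + b at all times after p: the end point
    moves with the tail, and earlier times only gain room. *)
Lemma flip_end_up_mem (S : walk n) : S \in A -> flip_end c S true \in A.
Proof.
move=> hS; apply/mem_culm => k hk.
have /mem_culm hS' := hS.
have := hS' k hk; have := hS' n (leqnn n); rewrite !heightE //.
have hpn : (p < n <= n)%N by rewrite pn leqnn.
have := ups_flip_end true hS hpn; have [hkp|hpk] := leqP k p.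
  rewrite (ups_flip_end_lo _ _ hkp).
  by clear; case: letter => /=; nia.
have hkk : (p < k <= n)%N by rewrite hpk.
have := ups_flip_end true hS hkk.
by clear; case: letter => /=; nia.
Qed.

(** After p the two flipped paths coincide. Up to p, S lies below T and inherits its bound by the
    final height, while nonnegativity comes from S itself. *)
Lemma flip_end_down_mono (S T : walk n) : S \in A -> T \in A ->
  leW S T -> ups S false p = ups T false p ->
  flip_end c T false \in A -> flip_end c S false \in A.
Proof.
move=> /mem_culm hS /mem_culm hT hle heq /mem_culm h; apply/mem_culm => k hk.
have hpn : (p < n <= n)%N by rewrite pn leqnn.
have := h k hk; rewrite !heightE // !(ups_flip_end_hi _ _ hpn) heq.
have [hkp|hpk] := leqP k p; last first.
  by rewrite !ups_flip_end_hi ?hpk // heq.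
rewrite !(ups_flip_end_lo _ _ hkp); have := hle k hk.
have /andP[+ _] := hS k hk; rewrite heightE //.
by move: (ups S _ k) (ups T _ k) (ups T _ p) => x y z; nia.
Qed.

Lemma update_end (S : walk n) m : ends m ->
  update a b Culminating S m =
  if flip_end c S m.1.2 \in A then flip_end c S m.1.2 else S.
Proof. by case: m => [[i e] d]; rewrite /ends /update /= => ->. Qed.

Lemma update_mono_end (S T : walk n) m : ends m -> S \in A -> T \in A ->
  leW S T -> leW (update a b Culminating S m) (update a b Culminating T m).
Proof.
move=> hm hS hT hle; rewrite !update_end //.
case: m.1.2.
  rewrite !flip_end_up_mem // => k hk; have [hkp|hpk] := leqP k p.
    by rewrite !ups_flip_end_lo // hle.
  by rewrite !ups_flip_end_hi ?hpk // !leq_add2r hle // ltnW.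
move=> k hk; have [hkp|hpk] := leqP k p.
  by case: ifP => _; case: ifP => _; rewrite ?ups_flip_end_lo // hle.
have hlep : (ups S false p <= ups T false p)%N by apply: hle; exact: ltnW pn.
have hkk : (p < k <= n)%N by rewrite hpk.
have eS := ups_flip_end false hS hkk; have eT := ups_flip_end false hT hkk.
have eS' := culm_ups_hi hS hkk; have eT' := culm_ups_hi hT hkk.
have lk := hle k hk.
have hdown := flip_end_down_mono hS hT hle.
have lS := leq_b1 (letter S false p); have lT := leq_b1 (letter T false p).
case: ifP => hA1; case: ifP => hA2; [lia|lia| |exact: lk].
(* Only T is flipped. As S refuses, the paths differ at p, and this strict inequality pays for the
   up step that T may lose. *)
have hlt : (ups S false p < ups T false p)%N.
  rewrite ltn_neqAle hlep andbT; apply/negP => /eqP heq.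
  by rewrite hdown in hA1.
by lia.
Qed.

Lemma flip_endK (S : walk n) e e' : flip_end c (flip_end c S e) e' = flip_end c S e'.
Proof. apply/ffunP => j; rewrite /flip_end !ffunE. by case: ltnP. Qed.

Lemma update_rev_end (S : walk n) m : ends m -> S \in A ->
  update a b Culminating S m != S ->
  update a b Culminating (update a b Culminating S m) (rev_move m) = S.
Proof.
move=> hm hS; rewrite update_end //; case: ifP => hA; last by rewrite eqxx.
move=> hne; rewrite update_end /= // flip_endK.
(* A path that was changed had the opposite letter at p; putting it back restores the whole tail. *)
suff -> : ~~ m.1.2 = letter S false p by rewrite culm_tail // hS.
move: hne; rewrite -{2}(culm_tail hS).
by case: m.1.2; case: letter => //; rewrite eqxx.
Qed.

Lemma climb_end (S : walk n) m : ends m -> m.1.2 -> S \in A ->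
  ~~ letter S false p -> (area S < area (update a b Culminating S m))%N.
Proof.
move=> hm he hS hp; rewrite update_end // he flip_end_up_mem //.
have hle : leW S (flip_end c S true).
  move=> k hk; have [hkp|hpk] := leqP k p; first by rewrite ups_flip_end_lo.
  have hkk : (p < k <= n)%N by rewrite hpk.
  by have := ups_flip_end true hS hkk; rewrite (negbTE hp); lia.
rewrite ltnNge; apply/negP => /(area_ge_eq hle) heq.
by move: hp; rewrite heq letter_flip_end // ltnn eqxx.
Qed.

End CulminatingEnd.

Lemma ends_local n F (m : move n) : ~~ local_move F m ->
  is_culminating F /\ ends m.
Proof. by rewrite /local_move negbK => /andP. Qed.

Lemma update_mono a b n F (S T : walk n) m : (0 < a)%N -> (0 < b)%N ->
  wf_family a b n F -> S \in paths_of a b n F -> T \in paths_of a b n F ->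
  leW S T -> leW (update a b F S m) (update a b F T m).
Proof.
move=> ha hb hwf; have [hl|/ends_local[]] := boolP (local_move F m).
  exact: update_mono_local.
by case: F hwf => //= hwf _ hm; apply: update_mono_end => //; rewrite -addn1.
Qed.

Lemma update_rev a b n F (S : walk n) m : (0 < a)%N -> (0 < b)%N ->
  wf_family a b n F -> S \in paths_of a b n F -> update a b F S m != S ->
  update a b F (update a b F S m) (rev_move m) = S.
Proof.
move=> ha hb hwf; have [hl|/ends_local[]] := boolP (local_move F m).
  exact: update_rev_local.
by case: F hwf => //= hwf _ hm; apply: update_rev_end => //; rewrite -addn1.
Qed.

(** * Climbing to the largest path *)

Lemma ups_run n (S : walk n) d i j :
  (forall k, (i <= k < i + j)%N -> letter S d k) -> ups S d (i + j) = (ups S d i + j)%N.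
Proof.
elim: j => [|j IH] h; first by rewrite !addn0.
by rewrite !addnS upsS IH ?h ?addn1 // => [|k hk]; [lia | apply: h; lia].
Qed.

Lemma climb_local a b n F (S : walk n) i d : local_move F (i, true, d) ->
  accepts a b F S (i, true, d) ->
  (area S < area (update a b F S (i, true, d)))%N.
Proof.
move=> hl hA.
have hu k (hk : (k <= n)%N) := ups_update a b S hl hk.
have hle : leW S (update a b F S (i, true, d)) by move=> k hk; have := hu k hk; lia.
rewrite ltnNge; apply/negP => /(area_ge_eq hle) heq.
by have := hu _ (ltn_ord i); rewrite hA -heq eqxx; lia.
Qed.

(** Follow the down steps of S to the right: S remains strictly below T, and an up step closing a
    valley must come, at the latest the extra letter [true]. *)
Lemma lt_valley n (S T : walk n) k :
  (k < n)%N -> (ups S false k.+1 < ups T false k.+1)%N -> ~~ letter S true k ->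
  exists i : 'I_n, flippable S (i, true, true) &&
    (ups S false i.+1 < ups T false i.+1)%N.
Proof.
have [m hm] := ubnP (n - k)%N; elim: m => // m IH in k hm *; move=> hk hlt hf.
have [hup|hdown] := boolP (letter S true k.+1).
  by exists (Ordinal hk); rewrite /flippable /= -(letter_lt S true hk) hup hlt (negbTE hf).
have hk1 : (k.+1 < n)%N.
  by rewrite ltnNge; apply/negP => hn; rewrite letter_ge in hdown.
apply: (IH k.+1) => //; first by lia.
have := ups_step T false k.+1; rewrite (upsS S false k.+1).
by rewrite (letter_lt S false hk1) -(letter_lt S true hk1) (negbTE hdown); lia.
Qed.

Lemma update_climb a b n F (S T : walk n) : (0 < a)%N -> (0 < b)%N ->
  wf_family a b n F -> S \in paths_of a b n F -> T \in paths_of a b n F ->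
  leW S T -> S != T -> exists m, (area S < area (update a b F S m))%N.
Proof.
move=> ha hb hwf hS hT hle hne.
case hF: (is_culminating F); last first.
  have {}hF := negbT hF.
  have hex : exists k, (k <= n)%N && (ups S false k < ups T false k)%N.
    apply: contrapT => hno; move: hne => /eqP; apply; apply: leW_anti => // k hk.
    by rewrite leqNgt; apply/negP => h; apply: hno; exists k; rewrite hk.
  (* At the first time where S is below T, S has just made a down step, from which [lt_valley]
     starts. *)
  case: (ex_minnP hex) => -[|k] /andP[hk hlt] hmin; first by rewrite !ups0 in hlt.
  have hk0 : ~~ letter S true k.
    have : ~~ ((k <= n)%N && (ups S false k < ups T false k)%N).
      by apply/negP => /hmin; rewrite ltnn.
    rewrite (ltnW hk) /= -leqNgt => hge; move: hlt.
    by rewrite !upsS !(letter_lt _ _ hk); case: (S _); case: (T _); lia.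
  have [i /andP[hf hi]] := lt_valley hk hlt hk0.
  have hl : local_move F (i, true, true) by rewrite /local_move (negbTE hF).
  exists (i, true, true); apply: climb_local => //; rewrite acceptsE // hf /=.
  (* The raised count is still at most that of T. *)
  have : box_ok a b n F i.+1 (ups S false i.+1).+1.
    apply: (@box_convex _ _ _ _ _ (ups S false i.+1) _ (ups T false i.+1)).
    - by rewrite leqnSn.
    - by move/(mem_box _ _ _ hF): hS; apply.
    - by move/(mem_box _ _ _ hF): hT; apply.
  by case: F hF {hwf hS hT hl}.
case: F hF hwf hS hT => //= _; rewrite addn1 => hn hS hT.
set p := (n - (ceil_ratio a b).+1)%N.
have n0 : (n.-1 < n)%N by lia.
have [hp|hp] := boolP (letter S false p); last first.
  exists (Ordinal n0, true, true); apply: climb_end => //.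
  by rewrite /ends /= prednK //; lia.
(* Without a down step S would dominate T. *)
have hex : exists k, (k < n)%N && ~~ letter S false k.
  apply: contrapT => hno; move: hne => /eqP; apply; apply: leW_anti => // k hk.
  have -> : ups S false k = (ups S false 0 + k)%N.
    rewrite -{1}[k]add0n; apply: ups_run => j /andP[_ hj]; apply/negPn/negP => h.
    by apply: hno; exists j; rewrite h andbT; lia.
  by rewrite ups0 add0n ups_le.
have hbd k : (k < n)%N && ~~ letter S false k -> (k <= n)%N by move=> /andP[/ltnW].
case: (ex_maxnP hex hbd) => k /andP[hk hkf] hmax.
have htrue j : (k < j < n)%N -> letter S false j.
  by move=> /andP[hkj hjn]; apply/negPn/negP => h; have := hmax j; rewrite hjn h /=; lia.
have hkp : (k < p)%N.
  rewrite ltnNge; apply/negP => hpk; move: hkf.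
  have [ek|hne'] := eqVneq k p; first by rewrite ek hp.
  have hpk' : (p < k < n)%N by rewrite hk andbT ltn_neqAle eq_sym hne'.
  have := culm_ups_hi ha hb hn hS (k := k); have := culm_ups_hi ha hb hn hS (k := k.+1).
  rewrite -/p upsS; case: letter => // h1 h2.
  by have := h1 _; have := h2 _; rewrite hp; lia.
have hk1 : (k.+1 < n)%N by rewrite /p in hkp; lia.
have hl : local_move Culminating ((Ordinal hk, true, true) : move n).
  by rewrite /local_move /ends /=; lia.
exists (Ordinal hk, true, true); apply: climb_local => //.
rewrite acceptsE // /flippable /= -(letter_lt S false hk) (negbTE hkf) eqxx /=.
rewrite (letter_lt S true hk1) -(letter_lt S false hk1) htrue ?ltnS ?leqnn //=.
have /mem_culm /(_ k.+1 hk) := hS; rewrite !heightE //.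
have -> : ups S false n = (ups S false k.+1 + (n - k.+1))%N.
  rewrite -ups_run ?subnKC // => j; exact: htrue.
(* After the last down step come at least c + 1 up steps. They climb at least a + b, which leaves
   room below the final height for the raised valley. *)
have := ceil_ratio_ge b ha; rewrite /p in hkp.
move: (ups S _ _) hkp hn hk1; move: (ceil_ratio a b) => c x h1 h2 h3 h4.
have : (c.+1 <= n - k.+1)%N by lia.
have : ((n - k.+1)%N%:Z = n%:Z - k.+1%:Z) by lia.
move: (n - k.+1)%N h4 => z h4 hz hcz; nia.
Qed.

(** * Law of the driven chain *)

Lemma measure_fin_partition (R : realType) (d : measure_display)
    (Omega : measurableType d) (P : probability Omega R) (I : finType)
    (E : I -> set Omega) (F : set Omega) :
  (forall i, measurable (E i)) -> trivIset setT E -> F = \bigcup_i E i ->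
  P F = (\sum_(i : I) P (E i))%E.
Proof.
move=> mE tE ->.
have sT : [set` index_enum I] = [set: I].
  by apply/seteqP; split => i //= _; rewrite mem_index_enum.
rewrite -sT measure_fin_bigcup; last by [].
- by rewrite -fsbig_seq // /index_enum -enumT enum_uniq.
- exact: finite_finset.
- exact: sub_trivIset tE.
Qed.

Section Chain.
Variables (R : realType) (n : nat) (St : Type) (step : St -> move n -> St).

(** The state space is arbitrary, to cover both a single path and a coupled pair. *)
Fixpoint run (x : nat -> move n) (t : nat) (s : St) : St :=
  if t is k.+1 then run x k (step s (x k)) else s.

(** The transition operator acts on functions: its t-th iterate gives the mean of f after t steps
    from s. *)
Definition trans (f : St -> R) (s : St) : R :=
  \sum_(m : move n) move_law R m * f (step s m).

Definition indic_of (phi : pred St) (s : St) : R := (phi s)%:R.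

Variables (d : measure_display) (Omega : measurableType d).
Variables (P : probability Omega R) (X : nat -> Omega -> move n).
Hypothesis hX : iid_moves P X.

Definition cylinder (phi : pred St) (t l : nat) (v : nat -> move n) (s : St) :
    set Omega :=
  [set w | (forall k, (t <= k < t + l)%N -> X k w = v k) /\
           phi (run (fun k => X k w) t s)].

(* The moves of the times -t, ..., -1 are consumed oldest first, i.e. index t - 1
   first; keeping track of the indices from t on makes the induction on t
   go through. *)
Lemma cylinder_prob phi t l v s :
  measurable (cylinder phi t l v s) /\
  P (cylinder phi t l v s) =
  ((\prod_(t <= k < t + l) move_law R (v k)) * iter t trans (indic_of phi) s)%:E.
Proof.
case: hX => mX lawX indX.
elim: t => [|t IH] in l v s *.
  rewrite add0n /indic_of /=.
  have hcap : [set w | forall k, (k < l)%N -> X k w = v k] =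
      \bigcap_(k in [set` iota 0 l]) (X k @^-1` [set v k]).
    apply/seteqP; split => w /= h k; first by rewrite /= mem_iota /= => /h.
    by move=> hk; apply: h; rewrite /= mem_iota.
  have mcap : measurable [set w | forall k, (k < l)%N -> X k w = v k].
    rewrite hcap; apply: fin_bigcap_measurable => [|k _]; last exact: mX.
    exact: finite_seq.
  have hP : P [set w | forall k, (k < l)%N -> X k w = v k] =
      (\prod_(0 <= k < l) move_law R (v k))%:E.
    rewrite hcap indX ?iota_uniq // /index_iota subn0 -prodEFin.
    by apply: eq_bigr => k _; rewrite lawX.
  have -> : cylinder phi 0 l v s =
      if phi s then [set w | forall k, (k < l)%N -> X k w = v k] else set0.
    by apply/seteqP; split => w; rewrite /cylinder /=; case: (phi s) => //= -[].
  by case: (phi s); rewrite ?mulr1 ?mulr0 ?measure0.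
(* Split according to the move at index t: the block of prescribed indices grows by one on the
   left. *)
pose v' m k := if k == t then m else v k.
pose E m := cylinder phi t l.+1 (v' m) (step s m).
have hE : cylinder phi t.+1 l v s = \bigcup_m E m.
  apply/seteqP; split => w /=.
    move=> [hw hphi]; exists (X t w) => //; split=> // k hk; rewrite /v'.
    by case: eqP => [->//|hkt]; apply: hw; lia.
  move=> [m _] [hw hphi]; have ht : X t w = m.
    by rewrite hw ?/v' ?eqxx //; lia.
  split; last by move: hphi; rewrite /= ht.
  move=> k hk; rewrite hw /v'; last by lia.
  by rewrite gtn_eqF //; lia.
have tE : trivIset setT E.
  apply/trivIsetP => m m' _ _ /eqP hm; apply/seteqP; split => // w [] [h1 _] [h2 _].
  apply: hm; have ht : (t <= t < t + l.+1)%N by lia.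
  by have := h1 _ ht; have := h2 _ ht; rewrite /v' eqxx => -> ->.
split.
  rewrite hE; apply: fin_bigcup_measurable => [|m _]; first exact: finite_finset.
  exact: (IH _ _ _).1.
rewrite (measure_fin_partition P (fun m => (IH l.+1 (v' m) (step s m)).1) tE hE).
rewrite (eq_bigr (fun m => ((\prod_(t.+1 <= k < t.+1 + l) move_law R (v k)) *
   (move_law R m * iter t trans (indic_of phi) (step s m)))%:E)); last first.
  move=> m _; rewrite (IH _ _ _).2; congr EFin; rewrite mulrA; congr (_ * _).
  rewrite addnS addSn big_ltn ?leq_addr // /v' eqxx mulrC; congr (_ * _).
  by apply: eq_big_nat => k /andP[hk _]; rewrite gtn_eqF.
by rewrite sumEFin -mulr_sumr.
Qed.

Definition event (phi : pred St) (t : nat) (s : St) : set Omega :=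
  [set w | phi (run (fun k => X k w) t s)].

Lemma event_cylinder phi t s : event phi t s = cylinder phi t 0 (fun k => X k point) s.
Proof. by apply/seteqP; split => [w h|w []//]; split => // k; rewrite addn0; lia. Qed.

Lemma event_measurable phi t s : measurable (event phi t s).
Proof. by rewrite event_cylinder; exact: (cylinder_prob _ _ _ _ _).1. Qed.

Lemma event_prob phi t s : P (event phi t s) = (iter t trans (indic_of phi) s)%:E.
Proof.
by rewrite event_cylinder (cylinder_prob _ _ _ _ _).2 addn0 big_geq // mul1r.
Qed.

End Chain.

Lemma weight_ge (R : realType) n i : (0 < n)%N -> (i <= n)%N ->
  1 / (4 * n%:R ^+ 2) <= weight R n i.
Proof.
move=> n0 hi; rewrite /weight lerDr.
have hiR : (i%:R : R) <= n%:R by rewrite ler_nat.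
have i0 : 0 <= i%:R :> R := ler0n _ _.
have n0R : 0 < n%:R :> R by rewrite ltr0n.
apply: mulr_ge0; first by apply: mulr_ge0 => //; lra.
by apply: divr_ge0 => //; do 2 apply: mulr_ge0 => //; lra.
Qed.

(** The summand 1/(4 n^2) of the weights, times 1/4 for the two uniform signs, bounds every move
    from below. *)
Lemma move_law_ge (R : realType) n (m : move n) :
  1 / (16 * n%:R ^+ 2) <= move_law R m.
Proof.
case: m => [[i e] d]; have n0 : (0 < n)%N := leq_ltn_trans (leq0n i) (ltn_ord i).
have := weight_ge R n0 (ltn_ord i); rewrite /move_law.
have -> : 1 / (16 * n%:R ^+ 2) = 1 / (4 * n%:R ^+ 2) * (1 / 2) * (1 / 2) :> R.
  by field; rewrite pnatr_eq0 -lt0n.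
by move=> h; lra.
Qed.

Lemma move_law_ge0 (R : realType) n (m : move n) : 0 <= move_law R m.
Proof. by apply: le_trans (move_law_ge R m); rewrite divr_ge0 // mulr_ge0 // sqr_ge0. Qed.

(** The total mass is read off the existence of [X]: the sure event of a one-step chain with a
    single state has probability 1. *)
Lemma move_law_sum (R : realType) (n : nat) (d : measure_display)
    (Omega : measurableType d) (P : probability Omega R)
    (X : nat -> Omega -> move n) : iid_moves P X ->
  \sum_(m : move n) move_law R m = 1.
Proof.
move=> hX; have := event_prob (fun (_ : unit) (_ : move n) => tt) hX predT 1 tt.
rewrite (_ : event _ _ _ _ _ = setT); last by apply/seteqP; split.
rewrite probability_setT => -[->] /=.
by rewrite /trans /indic_of; apply: eq_bigr => m _; rewrite mulr1.
Qed.

(** * Coalescence and invariance of the uniform law *)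

Section Trans.
Variables (R : realType) (n : nat) (St : Type) (step : St -> move n -> St).
Hypothesis hlaw : \sum_(m : move n) move_law R m = 1.
Variable inv : St -> Prop.
Hypothesis hinv : forall s m, inv s -> inv (step s m).
Implicit Types (f g : St -> R).

Lemma trans_le f g : (forall s, inv s -> f s <= g s) ->
  forall s, inv s -> trans step f s <= trans step g s.
Proof.
move=> hfg s hs; apply: ler_sum => m _; apply: ler_wpM2l; first exact: move_law_ge0.
by apply: hfg; apply: hinv.
Qed.

Lemma iter_trans_le f g t : (forall s, inv s -> f s <= g s) ->
  forall s, inv s -> iter t (trans step) f s <= iter t (trans step) g s.
Proof. by move=> hfg; elim: t => //= t IH s hs; apply: trans_le. Qed.

Lemma trans_cst (c : R) s : trans step (fun=> c) s = c.
Proof. by rewrite /trans -mulr_suml hlaw mul1r. Qed.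

Lemma iter_trans_le_cst f t (c : R) : (forall s, inv s -> f s <= c) ->
  forall s, inv s -> iter t (trans step) f s <= c.
Proof.
move=> hf; elim: t => //= t IH s hs; rewrite -(trans_cst c s).
exact: trans_le.
Qed.

Lemma trans_scale f (c : R) s : trans step (fun u => c * f u) s = c * trans step f s.
Proof. by rewrite /trans mulr_sumr; apply: eq_bigr => m _; rewrite mulrCA. Qed.

Lemma iter_trans_contract f (q : R) t : 0 <= q ->
  (forall s, inv s -> trans step f s <= q * f s) ->
  forall s, inv s -> iter t (trans step) f s <= q ^+ t * f s.
Proof.
move=> q0 hf; elim: t => [|t IH] s hs /=; first by rewrite mul1r.
apply: le_trans (trans_le IH hs) _.
rewrite trans_scale exprSr -mulrA; apply: ler_wpM2l; first exact: exprn_ge0.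
exact: hf.
Qed.

End Trans.

Section Coupling.
Variables (R : realType) (a b n : nat) (F : path_family).
Hypotheses (n0 : (0 < n)%N) (ha : (0 < a)%N) (hb : (0 < b)%N).
Hypothesis hwf : wf_family a b n F.
Hypothesis hlaw : \sum_(m : move n) move_law R m = 1.
Let A := paths_of a b n F.

Definition update2 (ST : walk n * walk n) (m : move n) : walk n * walk n :=
  (update a b F ST.1 m, update a b F ST.2 m).

Definition ordered (ST : walk n * walk n) : Prop :=
  [/\ ST.1 \in A, ST.2 \in A & leW ST.1 ST.2].

Definition distinct (ST : walk n * walk n) : bool := ST.1 != ST.2.

Lemma ordered_update2 ST m : ordered ST -> ordered (update2 ST m).
Proof.
by case=> h1 h2 h12; split; rewrite /= ?update_mem //; apply: update_mono.
Qed.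

Let delta : R := 1 / (16 * n%:R ^+ 2).

Let delta_gt0 : 0 < delta.
Proof. by rewrite /delta divr_gt0 // mulr_gt0 // exprn_gt0 // ltr0n. Qed.

Let delta_le1 : delta <= 1.
Proof.
pose m0 : move n := (Ordinal n0, true, true).
apply: le_trans (move_law_ge R m0) _; rewrite -[leRHS]hlaw (bigD1 m0) //=.
by rewrite lerDl; apply: sumr_ge0 => m _; apply: move_law_ge0.
Qed.

Notation Q := (trans update2).

Lemma iter_diag (f : walk n * walk n -> R) t S : (forall S, f (S, S) = 0) ->
  iter t Q f (S, S) = 0.
Proof.
move=> hf; elim: t S => [|t IH] S //=.
by rewrite /trans big1 // => m _; rewrite /update2 /= IH mulr0.
Qed.

(** While S and T differ, some move of probability at least [delta] raises the area of S. A run of j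
    such moves would exceed the bound on areas, so the paths merge along it; on the remaining mass f
    is bounded by c. *)
Lemma coalesce_step (f : walk n * walk n -> R) (c : R) j S T :
  (forall ST, ordered ST -> f ST <= c) -> (forall S, f (S, S) = 0) -> 0 <= c ->
  ordered (S, T) -> ((n * n).+1 <= area S + j)%N ->
  iter j Q f (S, T) <= (1 - delta ^+ j) * c.
Proof.
move=> hf hdiag c0; elim: j S T => [|j IH] S T hST harea.
  by have := area_bound S; lia.
have hpow : 0 <= 1 - delta ^+ j.+1 by rewrite subr_ge0 exprn_ile1 // ltW.
have [eST|hne] := eqVneq S T.
  by rewrite eST iter_diag // mulr_ge0.
have [hS hT hle] := hST; have [m0 hm0] := update_climb ha hb hwf hS hT hle hne.
rewrite /= /trans (bigD1 m0) //=.
have h1 : iter j Q f (update2 (S, T) m0) <= (1 - delta ^+ j) * c.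
  apply: IH; first exact: (ordered_update2 m0 hST).
  by rewrite addnS in harea; apply: leq_trans harea _; rewrite -addSn leq_add2r.
have h2 : \sum_(m | m != m0) move_law R m * iter j Q f (update2 (S, T) m) <=
    \sum_(m | m != m0) move_law R m * c.
  apply: ler_sum => m _; apply: ler_wpM2l; first exact: move_law_ge0.
  apply: (iter_trans_le_cst hlaw ordered_update2 j hf); exact: ordered_update2.
have h3 : \sum_(m | m != m0) move_law R m = 1 - move_law R m0.
  by have := hlaw; rewrite (bigD1 m0) //= => h; lra.
rewrite -mulr_suml h3 in h2.
have p0 := move_law_ge R m0; rewrite -/delta in p0.
apply: le_trans (lerD (ler_wpM2l (move_law_ge0 R m0) h1) h2) _.
rewrite exprS; have dj : 0 <= delta ^+ j by rewrite exprn_ge0 // ltW.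
move: (delta ^+ j) dj (move_law R m0) p0 => x x0 y hy.
rewrite -subr_ge0.
have -> : (1 - delta * x) * c - (y * ((1 - x) * c) + (1 - y) * c) =
  (y - delta) * (x * c) by ring.
by apply: mulr_ge0; [rewrite subr_ge0 | apply: mulr_ge0].
Qed.

(** A block of n^2 + 1 steps suffices for [coalesce_step] from any area, so blocks can be
    chained. *)
Lemma coalesce_geom : exists (N : nat) (q : R), [/\ 0 <= q, q < 1 &
  forall k t ST, ordered ST -> (k * N <= t)%N ->
    iter t Q (indic_of R distinct) ST <= q ^+ k].
Proof.
pose N := (n * n).+1; pose q := 1 - delta ^+ N.
have q0 : 0 <= q by rewrite subr_ge0 exprn_ile1 // ltW.
have q1 : q < 1 by rewrite ltrBlDr ltrDl exprn_gt0.
exists N, q; split=> // k t ST hST hkt.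
have hdiag t' S : iter t' Q (indic_of R distinct) (S, S) = 0.
  by apply: iter_diag => S'; rewrite /indic_of /distinct /= eqxx.
have hgeom : forall ST, ordered ST ->
    iter (k * N) Q (indic_of R distinct) ST <= q ^+ k.
  elim: k {t ST hST hkt} => [|k IH] [S T] hST.
    by rewrite mul0n expr0 /= /indic_of lern1 leq_b1.
  rewrite mulSn iterD exprS; apply: coalesce_step => //.
  - exact: exprn_ge0.
  - by rewrite leq_addl.
rewrite -(subnK hkt) iterD; exact: (iter_trans_le_cst hlaw ordered_update2).
Qed.

Lemma coalesce_eventually (eps : R) ST : 0 < eps -> ordered ST ->
  exists t0, forall t, (t0 <= t)%N ->
    iter t Q (indic_of R distinct) ST <= eps.
Proof.
move=> e0 hST; have [N [q [q0 q1 hq]]] := coalesce_geom.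
have hcv : (q ^+ k @[k --> \oo] --> (0 : R)).
  by apply: cvg_expr; rewrite ger0_norm.
have [k _ hk] : \forall k \near \oo, q ^+ k < eps.
  by apply: cvgr_lt hcv _ e0.
exists (k * N)%N => t ht; apply: le_trans (hq k t ST hST ht) _.
by apply: ltW; apply: hk => /=.
Qed.

(* Letting (S, m) correspond to (S', m'), where S' is the update of S by m and
   m' undoes it, is an involution which preserves the weights: the transition
   matrix is symmetric. *)
Lemma trans_uniform (f : walk n -> R) :
  \sum_(S in A) trans (update a b F) f S = \sum_(S in A) f S.
Proof.
pose psi (Sm : walk n * move n) := (update a b F Sm.1 Sm.2,
  if update a b F Sm.1 Sm.2 == Sm.1 then Sm.2 else rev_move Sm.2).
have psiA Sm : Sm.1 \in A -> (psi Sm).1 \in A by move=> h; rewrite /= update_mem.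
have rev_moveK m : rev_move (rev_move m) = m :> move n.
  by case: m => [[i e] d]; rewrite /rev_move /= !negbK.
have psiK Sm : Sm.1 \in A -> psi (psi Sm) = Sm.
  case: Sm => [S m] /= hS; rewrite /psi /=.
  have [eS|hne] := eqVneq (update a b F S m) S; first by rewrite !eS eqxx.
  by rewrite update_rev // eq_sym (negbTE hne) rev_moveK.
have law_psi Sm : move_law R (psi Sm).2 = move_law R Sm.2.
  by rewrite /psi /=; case: ifP => // _; case: (Sm.2) => [[i e] d].
transitivity (\sum_(Sm : walk n * move n | Sm.1 \in A)
    move_law R Sm.2 * f (psi Sm).1).
  by rewrite /trans pair_big_dep /=; apply: eq_bigl => Sm; rewrite andbT.
transitivity (\sum_(Sm : walk n * move n | Sm.1 \in A) move_law R Sm.2 * f Sm.1).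
  (* Extending by the identity outside A gives an involution of the whole product, as reindexing
     requires. *)
  pose psi' (Sm : walk n * move n) := if Sm.1 \in A then psi Sm else Sm.
  have psi'K : involutive psi'.
    move=> Sm; rewrite /psi'; case hS: (Sm.1 \in A); last by rewrite hS.
    by rewrite psiA // psiK.
  rewrite [RHS](reindex_inj (inv_inj psi'K)) /=.
  apply: eq_big => [Sm|Sm hS]; rewrite /psi'; first by case hS: (Sm.1 \in A) => //; rewrite psiA.
  by rewrite hS law_psi.
rewrite (eq_bigl (fun Sm => (Sm.1 \in A) && true)); last by move=> Sm; rewrite andbT.
rewrite -(pair_big_dep _ (fun _ _ => true) (fun S m => move_law R m * f S)) /=.
by apply: eq_bigr => S _; rewrite -mulr_suml hlaw mul1r.
Qed.

Lemma iter_trans_uniform (f : walk n -> R) t :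
  \sum_(S in A) iter t (trans (update a b F)) f S = \sum_(S in A) f S.
Proof. by elim: t => //= t <-; rewrite trans_uniform. Qed.

End Coupling.

(** * Correctness of the algorithm *)

Section Cftp.
Variables (a b n : nat) (F : path_family).
Hypotheses (n0 : (0 < n)%N) (ha : (0 < a)%N) (hb : (0 < b)%N).
Hypothesis hwf : wf_family a b n F.
Let A := paths_of a b n F.
Hypothesis hA : A != finset.set0.
Implicit Types (x : nat -> move n) (S T : walk n).

Lemma run_update x t S : run (update a b F) x t S = evolve a b F x t S.
Proof. by elim: t S => //= t IH S; rewrite IH. Qed.

Lemma run_update2 x t S T :
  run (update2 a b F) x t (S, T) = (evolve a b F x t S, evolve a b F x t T).
Proof. by elim: t S T => //= t IH S T; rewrite IH. Qed.

Lemma evolve_mem x t S : S \in A -> evolve a b F x t S \in A.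
Proof. by elim: t S => //= t IH S hS; apply: IH; apply: update_mem. Qed.

Lemma evolve_mono x t S T : S \in A -> T \in A -> leW S T ->
  leW (evolve a b F x t S) (evolve a b F x t T).
Proof.
elim: t S T => //= t IH S T hS hT hle.
by apply: IH; rewrite ?update_mem //; apply: update_mono.
Qed.

Lemma evolve_addn x t s S :
  evolve a b F x (t + s) S = evolve a b F x t (evolve a b F (fun k => x (t + k)%N) s S).
Proof. by elim: s S => [|s IH] S; rewrite ?addn0 // addnS /= IH. Qed.

Let bot := hat0 a b n F.
Let top := hat1 a b n F.

Definition coalesced x t := evolve a b F x t bot == evolve a b F x t top.

Lemma ordered_hats : ordered a b F (bot, top).
Proof.
have [h0 h0'] := hat0P ha hA; have [h1 h1'] := hat1P ha hA.
by split=> //=; apply: h0'.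
Qed.

(** Monotonicity squeezes the image of every member between those of the two extremes, so the last t
    steps form a constant map; older moves only change its argument. *)
Lemma coalesced_evolve x t s S T : coalesced x t -> S \in A -> T \in A ->
  evolve a b F x (t + s) S = evolve a b F x t T.
Proof.
have [h0 h0'] := hat0P ha hA; have [h1 h1'] := hat1P ha hA.
have const V : coalesced x t -> V \in A -> evolve a b F x t V = evolve a b F x t bot.
  move=> /eqP hc hV; apply: leW_anti; last by apply: evolve_mono => //; apply: h0'.
  by rewrite hc; apply: evolve_mono => //; apply: h1'.
by move=> hc hS hT; rewrite evolve_addn !const // evolve_mem.
Qed.

Lemma cftp_stateP x k :
  match cftp_result (cftp a b F x k) with
  | Some V => exists2 j, coalesced x (2 ^ j) & evolve a b F x (2 ^ j) bot = V
  | None => cftp_tau (cftp a b F x k) = (2 ^ k)%N /\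
            forall j, (j < k)%N -> ~~ coalesced x (2 ^ j)
  end.
Proof.
elim: k => [|k] //=; rewrite /cftp /= -/(cftp a b F x k).
set st := cftp a b F x k; rewrite /cftp_round.
case hres: (cftp_result st) => [S|]; first by rewrite hres.
case=> htau hnc; rewrite htau -/bot -/top; case: ifP => hc /=.
  by exists k.
split; first by rewrite expnS.
move=> j; rewrite ltnS leq_eqVlt => /orP[/eqP ->|]; last exact: hnc.
by rewrite /coalesced hc.
Qed.

(** All dyadic times with coalescence yield the same path, so the one at which the algorithm stops
    need not be singled out. *)
Lemma cftp_returnsP x S : cftp_returns a b F x S <->
  exists2 j, coalesced x (2 ^ j) & evolve a b F x (2 ^ j) bot = S.
Proof.
split=> [[k hk]|[j hc <-]]; first by have := cftp_stateP x k; rewrite hk.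
exists j.+1; have := cftp_stateP x j.+1.
case: cftp_result => [S'|[_ /(_ j)]]; last by rewrite hc ltnSn => /(_ isT).
have [h0 _ _] := ordered_hats.
move=> [j' hc' <-]; congr Some.
have [hjj|/ltnW hjj] := leqP (2 ^ j') (2 ^ j).
  by rewrite -(subnKC hjj) (coalesced_evolve _ hc' h0 h0).
by rewrite -(subnKC hjj) (coalesced_evolve _ hc h0 h0).
Qed.

Lemma cftp_returns_coalesced x S j T : cftp_returns a b F x S ->
  coalesced x (2 ^ j) -> T \in A -> evolve a b F x (2 ^ j) T = S.
Proof.
have [h0 _ _] := ordered_hats.
move=> /cftp_returnsP[j' hc' <-] hc hT.
have [hjj|/ltnW hjj] := leqP (2 ^ j') (2 ^ j).
  by rewrite -(subnKC hjj) (coalesced_evolve _ hc' hT h0).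
by rewrite -(subnKC hjj) (coalesced_evolve _ hc h0 hT).
Qed.

Variables (R : realType) (d : measure_display) (Omega : measurableType d).
Variables (P : probability Omega R) (X : nat -> Omega -> move n).
Hypothesis hX : iid_moves P X.

Let path w := fun k => X k w.

Definition uncoalesced t : set Omega := [set w | ~~ coalesced (path w) t].

Lemma uncoalesced_event t :
  uncoalesced t = event (update2 a b F) X (@distinct n) t (bot, top).
Proof.
by apply/seteqP; split => w; rewrite /event /= run_update2.
Qed.

Lemma uncoalesced_measurable t : measurable (uncoalesced t).
Proof. by rewrite uncoalesced_event; exact: event_measurable hX _ _ _. Qed.

Lemma uncoalesced_prob t : P (uncoalesced t) =
  (iter t (trans (update2 a b F)) (indic_of R (@distinct n)) (bot, top))%:E.
Proof. by rewrite uncoalesced_event (event_prob _ hX). Qed.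

Let returns S : set Omega := [set w | cftp_returns a b F (path w) S].

Lemma returns_measurable S : measurable (returns S).
Proof.
pose phi (ST : walk n * walk n) := (ST.1 == ST.2) && (ST.1 == S).
rewrite (_ : returns S = \bigcup_j event (update2 a b F) X phi (2 ^ j) (bot, top)).
  by apply: bigcup_measurable => j _; exact: event_measurable hX _ _ _.
apply/seteqP; split => w; rewrite /returns /=.
  move=> /cftp_returnsP[j hc hj]; exists j => //; rewrite /event /= run_update2.
  by apply/andP; split=> //=; apply/eqP.
move=> [j _]; rewrite /event /= run_update2 => /andP[hc /eqP hj].
by apply/cftp_returnsP; exists j.
Qed.

Lemma returns_uniform S : S \in A -> P (returns S) = (#|A|%:R^-1)%:E.
Proof.
move=> hS; have hlaw := move_law_sum hX.
have mR := returns_measurable S.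
have [r hr] : exists r, P (returns S) = r%:E.
  by exists (fine (P (returns S))); rewrite fineK // fin_num_measure.
rewrite hr; congr EFin.
have cA : 0 < #|A|%:R :> R by rewrite ltr0n card_gt0.
pose K t S0 := iter t (trans (update a b F)) (indic_of R (pred1 S)) S0.
(* The events that S is returned and that the chain from S0 ends in S differ only where the extreme
   paths have not merged. *)
have near eps : 0 < eps -> exists t, forall S0, S0 \in A -> `|r - K t S0| <= eps.
  move=> e0; have [t0 ht0] := coalesce_eventually n0 ha hb hwf hlaw e0 ordered_hats.
  exists (2 ^ t0)%N => S0 hS0.
  have hnc : (P (uncoalesced (2 ^ t0)) <= eps%:E)%E.
    by rewrite uncoalesced_prob lee_fin ht0 // ltnW // ltn_expl.
  have mK := event_measurable (update a b F) hX (pred1 S) (2 ^ t0) S0.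
  have hK := event_prob (update a b F) hX (pred1 S) (2 ^ t0) S0.
  have mU := uncoalesced_measurable (2 ^ t0).
  rewrite ler_norml lerBlDr lerBrDr addrC [_ + K _ _]addrC; apply/andP; split.
    rewrite lerBlDr.
    rewrite -lee_fin EFinD -hr -hK; apply: le_trans (leeD2l _ hnc).
    apply: le_trans (measureU2 _ _ _) => //.
    apply: le_measure; rewrite ?inE //; first exact: measurableU.
    move=> w; rewrite /event /= run_update => /eqP hw.
    have [hc|] := boolP (coalesced (path w) (2 ^ t0)); last by right.
    left; apply/cftp_returnsP; exists t0 => //.
    have [h0 _ _] := ordered_hats.
    by rewrite -hw -[LHS](coalesced_evolve 0 hc hS0 h0) addn0.
  rewrite -lee_fin EFinD -hr -hK; apply: le_trans (leeD2l _ hnc).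
  apply: le_trans (measureU2 _ _ _) => //.
  apply: le_measure; rewrite ?inE //; first exact: measurableU.
  move=> w; rewrite /event /= run_update => hw.
  have [hc|] := boolP (coalesced (path w) (2 ^ t0)); last by right.
  by left; apply/eqP; apply: cftp_returns_coalesced.
have hsum t : \sum_(S0 in A) K t S0 = 1.
  rewrite /K (iter_trans_uniform ha hb hwf hlaw) // (bigD1 S) //= /indic_of /= eqxx.
  by rewrite big1 ?addr0 // => S' /andP[_ /negbTE ->].
suff h : r * #|A|%:R = 1 by rewrite -[r](mulfK (lt0r_neq0 cA)) h mul1r.
(* r |A| - 1 is the sum over S0 of r - K t S0, with terms of size at most eps / |A|. *)
apply/eqP; rewrite -subr_eq0 -normr_le0; apply/ler_addgt0Pl => eps e0; rewrite addr0.
have [t ht] := near (eps / #|A|%:R) (divr_gt0 e0 cA).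
rewrite mulr_natr -[X in _ - X](hsum t) -sumr_const -sumrB.
apply: le_trans (ler_norm_sum _ _ _) _.
apply: le_trans (ler_sum _ ht) _.
by rewrite sumr_const -[leLHS]mulr_natr divfK // lt0r_neq0.
Qed.

Lemma returns_outside S : S \notin A -> returns S = set0.
Proof.
move=> hS; apply/seteqP; split=> // w /cftp_returnsP[j _ hj].
have [h0 _ _] := ordered_hats.
by move: hS; rewrite -hj evolve_mem.
Qed.

Lemma returns_prob S :
  P (returns S) = (if S \in A then #|A|%:R^-1 else 0)%:E.
Proof.
case: ifPn => hS; first exact: returns_uniform.
by rewrite returns_outside // measure0.
Qed.

Lemma terminates_prob : P [set w | exists S, cftp_returns a b F (path w) S] = 1%E.
Proof.
rewrite (measure_fin_partition P returns_measurable).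
- rewrite (eq_bigr _ (fun S _ => returns_prob S)) sumEFin -big_mkcond /=.
  by rewrite sumr_const -[X in X%:E]mulr_natr mulVf // pnatr_eq0 -lt0n card_gt0.
- apply/trivIsetP => S T _ _ /eqP hST; apply/seteqP; split=> // w [] hS hT; apply: hST.
  have [h0 _ _] := ordered_hats.
  have /cftp_returnsP[j hc <-] := hS.
  exact: cftp_returns_coalesced hT hc h0.
- by apply/seteqP; split => [w [S hS]|w [S _ hS]]; exists S.
Qed.

End Cftp.

(** * Contraction of the gap *)

Lemma area_update a b n F (S : walk n) i e d : local_move F (i, e, d) ->
  (area (update a b F S (i, e, d)) + accepts a b F S (i, e, d) * ~~ e =
   area S + accepts a b F S (i, e, d) * e)%N.
Proof.
move=> hl.
have sum_at (y : nat) : (\sum_(k < n.+1) (k == i.+1 :> nat) * y = y)%N.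
  have hi : (i.+1 < n.+1)%N := ltn_ord i.
  rewrite (bigD1 (Ordinal hi)) //= eqxx mul1n big1 ?addn0 // => k.
  by rewrite -val_eqE /= => /negbTE ->.
set x : nat := accepts _ _ _ _ _.
rewrite -[(x * ~~ e)%N]sum_at -[(x * e)%N]sum_at /area -!big_split /=.
apply: eq_bigr => k _; have := ups_update a b S hl (ltn_ord k : (k <= n)%N).
by rewrite /x; case: (_ == _); case: accepts; case: (e); rewrite /=; lia.
Qed.

Definition gap_at n (S T : walk n) d k : int := (ups T d k)%:Z - (ups S d k)%:Z.

(* Without constraints this is an equality.  If the paths touch at time i + 1
   they meet the same constraint there; if not, convexity of the constraint
   forbids rejecting an up flip of S or a down flip of T, and the other two
   rejections only decrease the left-hand side. *)
Lemma laplacian_bound a b n F (S T : walk n) i d : ~~ is_culminating F ->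
  S \in paths_of a b n F -> T \in paths_of a b n F -> leW S T ->
  ((accepts a b F T (i, true, d) : nat)%:Z - (accepts a b F T (i, false, d) : nat)%:Z) -
  ((accepts a b F S (i, true, d) : nat)%:Z - (accepts a b F S (i, false, d) : nat)%:Z)
  <= gap_at S T d i - 2 * gap_at S T d i.+1 + gap_at S T d i.+2.
Proof.
move=> hF hS hT hle; rewrite /gap_at.
have hl e : local_move F (i, e, d) by rewrite /local_move (negbTE hF).
have loc_box (V : walk n) k u : loc_ok a b F V k u = box_ok a b n F k u.
  by case: F hF {hS hT hl}.
have hi : (i < n)%N := ltn_ord i.
rewrite !acceptsE // !loc_box !flippable_ups.
have h0 : (ups S d i <= ups T d i)%N by apply: leW_delta => //; lia.
have h1 := hle _ hi.
have h2 : (ups S d i.+2 <= ups T d i.+2)%N by apply: leW_delta.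
have s1 := ups_step T d i; have s2 := ups_step T d i.+1.
have s1' := ups_step S d i; have s2' := ups_step S d i.+1.
have hSb : box_ok a b n F i.+1 (ups S false i.+1) by move/(mem_box _ _ _ hF): hS; apply.
have hTb : box_ok a b n F i.+1 (ups T false i.+1) by move/(mem_box _ _ _ hF): hT; apply.
rewrite !(ups_delta _ false d) // in h1 hSb hTb *.
have convex := @box_convex a b n F i.+1.
have [heq|hne] := eqVneq (ups S d i.+1) (ups T d i.+1).
  rewrite heq in s1' s2' *.
  case: (box_ok _ _ _ _ _ (ups T d i.+1).+1); case: (box_ok _ _ _ _ _ (ups T d i.+1).-1);
  rewrite ?andbT ?andbF; clear -h0 h2 s1 s2 s1' s2'; lia.
have -> : box_ok a b n F i.+1 (ups S d i.+1).+1 by apply: convex hSb hTb; lia.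
have -> : box_ok a b n F i.+1 (ups T d i.+1).-1 by apply: convex hSb hTb; lia.
case: (box_ok _ _ _ _ _ _); case: (box_ok _ _ _ _ _ _);
rewrite ?andbT ?andbF; clear -h0 h1 h2 s1 s2 s1' s2'; lia.
Qed.

(** Discrete Green identity, with its boundary terms at 0 and N. *)
Lemma sum_by_parts (R : comNzRingType) (p D : nat -> R) N :
  \sum_(i < N) p i.+1 * (D i - 2 * D i.+1 + D i.+2) =
  \sum_(i < N) (p i - 2 * p i.+1 + p i.+2) * D i.+1
  + p 1%N * D 0%N - p 0%N * D 1%N + p N * D N.+1 - p N.+1 * D N.
Proof.
elim: N => [|N IH]; first by rewrite !big_ord0; ring.
by rewrite !big_ord_recr /= IH; ring.
Qed.

Definition kappa (R : realType) (n : nat) : R := 3 / (2 * n%:R ^+ 2 * (n%:R + 1)).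

Lemma kappa_ge0 (R : realType) n : 0 <= kappa R n.
Proof. by rewrite divr_ge0 // !mulr_ge0 // addr_ge0. Qed.

Lemma weight_laplacian (R : realType) n i :
  weight R n i - 2 * weight R n i.+1 + weight R n i.+2 = - 2 * kappa R n.
Proof.
rewrite /weight -/(kappa R n); move: (kappa R n) (1 / _) => k z.
by rewrite -(natr1 i.+1) -natr1; ring.
Qed.

Lemma weight_last (R : realType) n :
  weight R n n - weight R n n.+1 = kappa R n.
Proof.
by rewrite /weight -/(kappa R n); move: (kappa R n) (1 / _) => k z; rewrite -natr1; ring.
Qed.

(** Summing by parts gives -2 kappa times the sum of D. The boundary term at n adds kappa D n,
    absorbed by half of this; the one at 0 has the right sign. D n.+1 = D n expresses that both
    paths receive the same extra letter. *)
Lemma weighted_laplacian_le (R : realType) n (D : nat -> R) :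
  D 0%N = 0 -> D n.+1 = D n -> (forall k, (k <= n.+1)%N -> 0 <= D k) ->
  \sum_(i < n) weight R n i.+1 * (D i - 2 * D i.+1 + D i.+2) <=
  - kappa R n * \sum_(k < n.+1) D k.
Proof.
move=> D0 Dn Dge0; rewrite sum_by_parts D0 Dn mulr0 addr0.
rewrite (eq_bigr (fun i : 'I_n => - 2 * kappa R n * D i.+1)); last first.
  by move=> i _; rewrite weight_laplacian.
have -> : \sum_(k < n.+1) D k = \sum_(i < n) D i.+1.
  by rewrite big_ord_recl D0 add0r; apply: eq_bigr => i _; rewrite lift0.
rewrite -mulr_sumr.
have hw0 : 0 <= weight R n 0 * D 1%N.
  rewrite mulr_ge0 ?Dge0 // /weight !mul0r add0r divr_ge0 // mulr_ge0 // sqr_ge0.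
have hwn : weight R n n * D n - weight R n n.+1 * D n = kappa R n * D n.
  by rewrite -mulrBl weight_last.
have hDn : D n <= \sum_(i < n) D i.+1.
  case: n {hw0 hwn Dn} Dge0 => [|n] Dge0; first by rewrite D0 big_ord0.
  rewrite big_ord_recr lerDr sumr_ge0 // => i _; apply: Dge0.
  by have := ltn_ord i; rewrite /=; lia.
have := ler_wpM2l (kappa_ge0 R n) hDn.
by move: hw0 hwn; lra.
Qed.

Section Drift.
Variables (R : realType) (a b n : nat) (F : path_family).
Hypothesis n0 : (0 < n)%N.
Hypothesis hF : ~~ is_culminating F.
Hypothesis hlaw : \sum_(m : move n) move_law R m = 1.

Definition gap (ST : walk n * walk n) : R := (area ST.2)%:R - (area ST.1)%:R.

Lemma gap_contract ST : ordered a b F ST ->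
  trans (update2 a b F) gap ST <= (1 - kappa R n / 2) * gap ST.
Proof.
case: ST => S T [/= hS hT hle].
have hl m : local_move F (m : move n) by rewrite /local_move (negbTE hF).
pose acc (V : walk n) (i : 'I_n) (e d : bool) : R :=
  (accepts a b F V (i, e, d))%:R * (if e then 1 else -1).
have hupd (V : walk n) i e d :
    (area (update a b F V (i, e, d)))%:R = (area V)%:R + acc V i e d :> R.
  have := area_update a b V (hl (i, e, d)); move/(congr1 (fun x => x%:R : R)).
  by rewrite !natrD !natrM /acc; case: (e) => /=; lra.
pose D k : R := (ups T false k)%:R - (ups S false k)%:R.
have hDd d k : (k <= n.+1)%N -> (ups T d k)%:R - (ups S d k)%:R = D k.
  rewrite leq_eqVlt => /orP[/eqP ->|hk]; last by rewrite /D !(ups_delta _ d false).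
  by rewrite /D !upsS !letter_ge // !(ups_delta _ d false) // !natrD; ring.
have hacc i d : \sum_(e : bool) (acc T i e d - acc S i e d) <= D i - 2 * D i.+1 + D i.+2.
  have := laplacian_bound i d hF hS hT hle; rewrite /gap_at -(ler_int R).
  rewrite !(rmorphD, rmorphN, rmorphM) /= -!pmulrn.
  have hi := ltn_ord i; rewrite !hDd //; try lia.
  by rewrite big_bool /acc /=; lra.
rewrite /trans; pose E i e d := acc T i e d - acc S i e d.
rewrite (eq_bigr (fun m : move n => move_law R m * gap (S, T) +
    weight R n m.1.1.+1 * (1 / 4) * E m.1.1 m.1.2 m.2)); last first.
  move=> [[i e] d] _; rewrite /gap /= !hupd /E /move_law; lra.
rewrite big_split /= -mulr_suml hlaw mul1r.
have -> : (1 - kappa R n / 2) * gap (S, T) = gap (S, T) - kappa R n / 2 * gap (S, T).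
  by ring.
rewrite lerD2l.
have -> : \sum_(m : move n) weight R n m.1.1.+1 * (1 / 4) * E m.1.1 m.1.2 m.2 =
    \sum_(i < n) weight R n i.+1 * (1 / 4) * \sum_(d : bool) \sum_(e : bool) E i e d.
  rewrite -(pair_bigA _ (fun (ie : 'I_n * bool) d =>
    weight R n ie.1.+1 * (1 / 4) * E ie.1 ie.2 d)) /=.
  rewrite -(pair_bigA _ (fun (i : 'I_n) e =>
    \sum_(d : bool) weight R n i.+1 * (1 / 4) * E i e d)) /=.
  apply: eq_bigr => i _; rewrite exchange_big mulr_sumr; apply: eq_bigr => d _.
  by rewrite mulr_sumr.
have hw (i : 'I_n) : 0 <= weight R n i.+1.
  by apply: le_trans (weight_ge R n0 (ltn_ord i)); rewrite divr_ge0 // mulr_ge0 // sqr_ge0.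
(* For each extra letter the two flips together contribute at most the Laplacian; the two letters
   turn 1/4 into 1/2. *)
have hstep : \sum_(i < n) weight R n i.+1 * (1 / 4) * \sum_(d : bool) \sum_(e : bool) E i e d <=
    (1 / 2) * \sum_(i < n) weight R n i.+1 * (D i - 2 * D i.+1 + D i.+2).
  rewrite mulr_sumr; apply: ler_sum => i _.
  rewrite big_bool /=; have h1 := hacc i true; have h2 := hacc i false.
  have := ler_wpM2l (hw i) (lerD h1 h2); rewrite -/(E i) /E; lra.
apply: le_trans hstep _.
have D0 : D 0%N = 0 by rewrite /D !ups0 subrr.
have Dn : D n.+1 = D n.
  by rewrite -(hDd true n) // -(hDd true n.+1) // !upsS !letter_ge // !natrD; ring.
have Dge0 k : (k <= n.+1)%N -> 0 <= D k by move=> hk; rewrite subr_ge0 ler_nat leW_delta.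
have := weighted_laplacian_le D0 Dn Dge0.
have -> : gap (S, T) = \sum_(k < n.+1) D k.
  by rewrite /gap /= /area !natr_sum -sumrB.
lra.
Qed.

End Drift.

(** * Expected running time *)

Section Measure.
Variables (R : realType) (d : measure_display) (T : measurableType d).
Variable (mu : {measure set T -> \bar R}).
Local Open Scope ereal_scope.

(* Unlike ge0_le_integral, no measurability is needed. *)
Lemma integral_le_nonneg (f g : T -> \bar R) : (forall x, 0 <= f x) ->
  (forall x, f x <= g x) -> \int[mu]_x f x <= \int[mu]_x g x.
Proof.
move=> f0 fg; have g0 x : 0 <= g x := le_trans (f0 x) (fg x).
rewrite !ge0_integralTE //; apply: le_ereal_sup => _ [h hf <-].
by exists h => // x; apply: le_trans (hf x) (fg x).
Qed.

(** Monotone convergence: an expected cost is bounded by the costs of the rounds times the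
    probabilities that they are run. *)
Lemma integral_indic_series_le (f : T -> \bar R) (c : nat -> R)
    (E : nat -> set T) (M : \bar R) :
  (forall j, 0 <= c j)%R -> (forall j, measurable (E j)) -> (forall x, 0 <= f x) ->
  (forall x, f x <= \sum_(0 <= j <oo) (c j * \1_(E j) x)%:E) ->
  (forall N, \sum_(0 <= j < N) (c j)%:E * mu (E j) <= M) ->
  \int[mu]_x f x <= M.
Proof.
move=> c0 mE f0 hf hM; apply: le_trans (integral_le_nonneg f0 hf) _.
have h0 j x : 0 <= (c j * \1_(E j) x)%:E by rewrite lee_fin mulr_ge0.
have mI j : measurable_fun setT (EFin \o (\1_(E j) : T -> R)).
  by apply/measurable_EFinP; apply: measurable_indic.
rewrite integral_nneseries //; last first.
  move=> j; under eq_fun do rewrite EFinM.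
  by apply: measurable_funeM; exact: mI.
have hint j : \int[mu]_x (c j * \1_(E j) x)%:E = (c j)%:E * mu (E j).
  transitivity (\int[mu]_x ((c j)%:E * (\1_(E j) x)%:E)).
    by apply: eq_integral => x hx; exact: EFinM.
  rewrite ge0_integralZl_EFin //; last exact: mI.
  by rewrite integral_indic // setIT.
rewrite (eq_eseriesr (fun j _ => hint j)).
apply: lime_le; last by apply: nearW => N; apply: hM.
by apply: is_cvg_nneseries => j _ _; rewrite mule_ge0 // lee_fin.
Qed.

End Measure.

Section Cost.
Variables (a b n : nat) (F : path_family).
Implicit Types (x : nat -> move n).

(* Round j + 1 is run only if round j, with tau = 2 ^ j, has failed. *)
Definition cost_bound x k : nat :=
  (2 + \sum_(j < k) 2 ^ j.+2 * ~~ coalesced a b F x (2 ^ j))%N.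

Lemma cost_bound_leq x k : (cost_bound x k <= cost_bound x k.+1)%N.
Proof. by rewrite /cost_bound big_ord_recr addnA leq_addr. Qed.

(** Until a path is returned, the 2^(k+1) updates of the coming round are already paid for. Draws
    are dominated by updates, since a round draws at most tau triples and performs 2 tau updates. *)
Lemma cftp_cost x k : let st := cftp a b F x k in
  (cftp_drawn st <= cftp_updates st)%N /\
  (if cftp_result st is Some _ then (cftp_updates st <= cost_bound x k)%N
   else cftp_tau st = (2 ^ k)%N /\ (cftp_updates st + 2 ^ k.+1 <= cost_bound x k)%N).
Proof.
elim: k => [|k] /=; first by rewrite /cost_bound big_ord0.
rewrite /cftp /= -/(cftp a b F x k).
set st := cftp a b F x k; rewrite /cftp_round.
case hres: (cftp_result st) => [V|] /=.
  by rewrite hres => -[h1 h2]; split=> //; apply: leq_trans (cost_bound_leq x k).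
move=> [h1 [-> h2]]; have h3 := cost_bound_leq x k.
rewrite expnS in h2; have hd : (maxn (cftp_drawn st) (2 ^ k) <=
    cftp_updates st + 2 * 2 ^ k)%N by lia.
case: ifP => hc /=; split=> //; first by lia.
rewrite expnS; split=> //.
rewrite /cost_bound big_ord_recr /= -/(cost_bound x k) /coalesced hc.
by rewrite addnA -/(cost_bound x k) muln1 !expnS; lia.
Qed.

Lemma cftp_cost_le x k :
  (cftp_drawn (cftp a b F x k) <= cost_bound x k)%N /\
  (cftp_updates (cftp a b F x k) <= cost_bound x k)%N.
Proof.
have [h1 h2] := cftp_cost x k.
have h3 : (cftp_updates (cftp a b F x k) <= cost_bound x k)%N.
  by case: cftp_result h2 => [_|[_]] //; lia.
by split=> //; apply: leq_trans h3.
Qed.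

End Cost.

Lemma ln2_ge (R : realType) : 1 / 2 <= ln 2 :> R.
Proof.
rewrite -ler_expR lnK ?posrE //.
have := expR_ge1Dx (- (1 / 2) : R); rewrite expRN => h.
have e0 := expR_gt0 (1 / 2 : R).
by rewrite -[leLHS]invrK invf_ple ?posrE ?invr_gt0 //; lra.
Qed.

(** Square the inequality 1 + z/2 <= exp (z/2). *)
Lemma expR_ge_quadratic (R : realType) (z : R) : 0 <= z ->
  1 + z + z ^+ 2 / 4 <= expR z.
Proof.
move=> z0; have -> : z = 2%:R * (z / 2) by field.
rewrite expRM_natl; have h := expR_ge1Dx (z / 2).
have h0 : 0 <= 1 + z / 2 by lra.
have := ler_pM h0 h0 h h; rewrite -!expr2.
by lra.
Qed.

(* With y = t / A, the hypotheses give p t <= 8 / ((1 + y) (1 + 2 y)), and t times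
   this bound is 8 A (phi (2 t) - phi t) for phi x = x / (A + x) <= 1: the sum
   over the powers of 2 telescopes. *)
Lemma sum_dyadic_le (R : realType) (L A : R) (p : nat -> R) N :
  1 <= L -> 0 < A ->
  (forall t, 0 <= p t) ->
  (forall t, p t <= 1) ->
  (forall t, p t <= expR (L * (1 - t%:R / A))) ->
  \sum_(0 <= j < N) 2 ^+ j * p (2 ^ j)%N <= 8 * A.
Proof.
move=> L1 A0 p0 p1 pe.
pose phi (x : R) := x / (A + x).
have hp t : (0 < t)%N -> t%:R * p t <= 8 * A * (phi (2 * t%:R) - phi t%:R).
  move=> t0; have T0 : 0 < t%:R :> R by rewrite ltr0n.
  pose y : R := t%:R / A; have y0 : 0 < y by rewrite divr_gt0.
  have hphi : 8 * A * (phi (2 * t%:R) - phi t%:R) = t%:R * (8 / ((1 + y) * (1 + 2 * y))).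
    by rewrite /phi /y; field; rewrite !lt0r_neq0 //; lra.
  rewrite hphi; apply: ler_wpM2l; first exact: ltW.
  rewrite ler_pdivlMr; last by nra.
  (* For y <= 1 use p <= 1 and (1 + y)(1 + 2 y) <= 6. Beyond, L >= 1 gives p <= exp (1 - y), while 8
     exp (y - 1) >= 2 y^2 + 4 y + 2. *)
  have [y1|y1] := lerP y 1.
    have : p t * ((1 + y) * (1 + 2 * y)) <= 1 * ((1 + y) * (1 + 2 * y)).
      by apply: ler_wpM2r => //; nra.
    by nra.
  have hq := expR_ge_quadratic (ltW (_ : 0 < y - 1)).
  have {}hq : 1 + (y - 1) + (y - 1) ^+ 2 / 4 <= expR (y - 1) by apply: hq; lra.
  have hpe : p t <= (expR (y - 1))^-1.
    apply: le_trans (pe t) _; rewrite -expRN ler_expR -/y; nra.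
  have e0 := expR_gt0 (y - 1).
  apply: le_trans (_ : (expR (y - 1))^-1 * ((1 + y) * (1 + 2 * y)) <= _).
    by apply: ler_wpM2r hpe; nra.
  rewrite mulrC ler_pdivrMr //; nra.
have phi_lt1 x : 0 <= x -> phi x <= 1.
  by move=> x0; rewrite /phi ler_pdivrMr; lra.
have phi_ge0 x : 0 <= x -> 0 <= phi x.
  by move=> x0; rewrite /phi divr_ge0 //; lra.
apply: le_trans (_ : \sum_(0 <= j < N) (8 * A * (phi (2 ^+ j.+1) - phi (2 ^+ j))) <= _).
  apply: ler_sum => j _; have := hp (2 ^ j)%N (expn_gt0 2 j).
  by rewrite natrX exprS.
rewrite -mulr_sumr telescope_sumr //.
have h1 : phi (2 ^+ N) <= 1 by apply: phi_lt1; rewrite exprn_ge0.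
have h2 : 0 <= phi (2 ^+ 0) by apply: phi_ge0; rewrite exprn_ge0.
have : 8 * A * (phi (2 ^+ N) - phi (2 ^+ 0)) <= 8 * A * 1.
  by apply: ler_wpM2l; lra.
by rewrite mulr1.
Qed.

Section ExpectedTime.
Variables (R : realType) (a b n : nat) (F : path_family).
Hypotheses (n1 : (1 < n)%N) (ha : (0 < a)%N) (hb : (0 < b)%N).
Hypotheses (hwf : wf_family a b n F) (hA : paths_of a b n F != finset.set0).
Hypothesis hF : ~~ is_culminating F.
Variables (d : measure_display) (Omega : measurableType d).
Variables (P : probability Omega R) (X : nat -> Omega -> move n).
Hypothesis hX : iid_moves P X.

Let bot := hat0 a b n F.
Let top := hat1 a b n F.
Let n0 : (0 < n)%N := ltnW n1.
Let nR0 : 0 < n%:R :> R. Proof. by rewrite ltr0n. Qed.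
Let p t : R := iter t (trans (update2 a b F)) (indic_of R (@distinct n)) (bot, top).

(** Markov's inequality: distinct paths have an integer gap of at least 1, and the initial gap is at
    most n^2. The bound n^2 exp (- t / (4 n^3)) is written in the form of [sum_dyadic_le], with L =
    2 ln n and A = 8 n^3 ln n. *)
Lemma uncoalesced_le_expR t :
  p t <= expR (2 * ln n%:R * (1 - t%:R / (8 * n%:R ^+ 3 * ln n%:R))).
Proof.
have hlaw := move_law_sum hX.
have hinv := @ordered_update2 a b n F ha hb hwf.
have hord : ordered a b F (bot, top) := ordered_hats ha hA.
have ln0 : 0 < ln n%:R :> R by rewrite ln_gt0 // ltr1n.
have gap_ge0 (ST : walk n * walk n) : ordered a b F ST -> 0 <= gap R ST.
  by case=> _ _ hle; rewrite subr_ge0 ler_nat area_le.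
pose q : R := expR (- (1 / (4 * n%:R ^+ 3))).
have hq (ST : walk n * walk n) : ordered a b F ST ->
    trans (update2 a b F) (@gap R n) ST <= q * gap R ST.
  move=> hST; apply: le_trans (gap_contract n0 hF hlaw hST) _.
  apply: ler_wpM2r; first exact: gap_ge0.
  apply: le_trans (expR_ge1Dx _); rewrite lerD2l lerN2 /kappa.
  have n1R : 1 <= n%:R :> R by rewrite ler1n.
  rewrite -subr_ge0.
  (* kappa / 2 is at least 1/(4 n^3) because 3 n >= n + 1. *)
  have -> : 3 / (2 * n%:R ^+ 2 * (n%:R + 1)) / 2 - 1 / (4 * n%:R ^+ 3) =
    (2 * n%:R - 1) / (4 * n%:R ^+ 3 * (n%:R + 1)) :> R.
    by field; rewrite !lt0r_neq0 //; lra.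
  by rewrite divr_ge0 // ?mulr_ge0 ?exprn_ge0 //; lra.
have hgap : gap R (bot, top) <= n%:R ^+ 2.
  rewrite /gap /= lerBlDr; apply: le_trans (_ : (n * n)%:R <= _).
    by rewrite ler_nat area_bound.
  by rewrite natrM -expr2 lerDl.
have hind (ST : walk n * walk n) : ordered a b F ST -> indic_of R (@distinct n) ST <= gap R ST.
  move=> [_ _ hle]; rewrite /indic_of /distinct /gap.
  case: eqVneq => [->|hne] /=; first by rewrite subrr.
  rewrite lerBrDr -natrD ler_nat add1n ltnNge; apply/negP => h.
  by move/eqP: hne; apply; apply: area_ge_eq.
apply: le_trans (iter_trans_le hinv t hind hord) _.
apply: le_trans (iter_trans_contract hinv t (expR_ge0 _) hq hord) _.
apply: le_trans (ler_wpM2l (exprn_ge0 _ (expR_ge0 _)) hgap) _.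
have -> : n%:R ^+ 2 = expR (2 * ln n%:R) :> R by rewrite expRM_natl lnK ?posrE.
rewrite -expRM_natl -expRD ler_expR.
rewrite le_eqVlt; apply/orP; left; apply/eqP; field.
by rewrite !lt0r_neq0.
Qed.

Lemma uncoalesced_le1 t : p t <= 1.
Proof.
apply: (iter_trans_le_cst (move_law_sum hX) (@ordered_update2 a b n F ha hb hwf)).
  by move=> ST _; rewrite /indic_of lern1 leq_b1.
exact: ordered_hats.
Qed.

Lemma cftp_time_le (cdraw cupd : R) : 0 <= cdraw -> 0 <= cupd ->
  (\int[P]_w cftp_time cdraw cupd a b F (fun k => X k w) <=
   ((3 * cdraw + cupd) * (2 + 256 * (n%:R ^+ 3 * ln n%:R)))%:E)%E.
Proof.
move=> c1 c2; set c := 3 * cdraw + cupd.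
have c0 : 0 <= c by rewrite /c; lra.
(* Round j can be run only on [E j], and costs at most c 2^(j+1). *)
pose E j : set Omega := if j is j'.+1 then uncoalesced a b F X (2 ^ j') else setT.
have mE j : measurable (E j).
  by case: j => [|j] /=; [exact: measurableT | exact: (uncoalesced_measurable _ _ _ hX)].
have ln0 : 0 < ln n%:R :> R by rewrite ln_gt0 // ltr1n.
have ln12 : 1 / 2 <= ln n%:R :> R.
  by apply: le_trans (ln2_ge R) _; rewrite ler_ln ?posrE // ler_nat.
pose Aa : R := 8 * n%:R ^+ 3 * ln n%:R.
have A0 : 0 < Aa by rewrite /Aa !mulr_gt0 // exprn_gt0.
have pge0 t : 0 <= p t.
  rewrite -lee_fin /p -(uncoalesced_prob a b F hX); exact: measure_ge0.
apply: (@integral_indic_series_le _ _ _ _ _ (fun j => c * 2 ^+ j.+1) E).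
- by move=> j; rewrite mulr_ge0 // exprn_ge0.
- exact: mE.
- move=> w; apply: le_trans (ereal_sup_ubound _); last by exists 0%N.
  by rewrite /= lee_fin muln0 !mulr0 addr0.
- move=> w; apply: ge_ereal_sup => _ [k _ <-].
  have [h1 h2] := cftp_cost_le a b F (fun k => X k w) k.
  apply: le_trans (nneseries_lim_ge k.+1 _); last first.
    by move=> j _ _; rewrite lee_fin !mulr_ge0 // exprn_ge0.
  rewrite sumEFin lee_fin.
  apply: le_trans (_ : c * (cost_bound a b F (fun k => X k w) k)%:R <= _).
    rewrite natrM; have h1' : (cftp_drawn (cftp a b F (fun k => X k w) k))%:R <=
      (cost_bound a b F (fun k => X k w) k)%:R :> R by rewrite ler_nat.
    have h2' : (cftp_updates (cftp a b F (fun k => X k w) k))%:R <=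
      (cost_bound a b F (fun k => X k w) k)%:R :> R by rewrite ler_nat.
    have := ler_wpM2l c1 h1'; have := ler_wpM2l c2 h2'; rewrite /c; lra.
  rewrite big_nat_recl //= indicE in_setT mulr1 /cost_bound natrD mulrDr lerD //.
  rewrite natr_sum mulr_sumr big_mkord; apply: ler_sum => j _.
  rewrite natrM natrX -mulrA; apply: ler_wpM2l => //; apply: ler_wpM2l; first by rewrite exprn_ge0.
  rewrite indicE ler_nat; case hc: (coalesced _ _ _ _ _) => //=.
  by rewrite mem_set // /uncoalesced /= hc.
- move=> N; apply: le_trans (_ : (\sum_(0 <= j < N.+1) (c * 2 ^+ j.+1)%:E * P (E j) <= _)%E).
    by rewrite big_nat_recr //= leeDl // mule_ge0 // lee_fin mulr_ge0 // exprn_ge0.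
  rewrite big_nat_recl //= probability_setT mule1.
  under eq_bigr => j _ do rewrite (uncoalesced_prob a b F hX) -EFinM.
  rewrite sumEFin -EFinD lee_fin [leRHS]mulrDr; apply: lerD; first by rewrite expr1.
  (* Here 2 ln n >= 1 because n >= 2. The constant 256 is 4 from the costs, 8 from the dyadic sum
     and 8 from [Aa]. *)
  have := sum_dyadic_le N _ A0 pge0 uncoalesced_le1 uncoalesced_le_expR.
  move=> /(_ _) h; have {}h := h (_ : 1 <= 2 * ln n%:R).
  have {}h : \sum_(0 <= j < N) 2 ^+ j * p (2 ^ j) <= 8 * Aa by apply: h; lra.
  rewrite (eq_bigr (fun j => (c * 4) * (2 ^+ j * p (2 ^ j)))); last first.
    by move=> j _; rewrite !exprS /p; ring.
  rewrite -mulr_sumr; apply: le_trans (ler_wpM2l _ h) _; first by lra.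
  by rewrite /Aa; lra.
Qed.

End ExpectedTime.

Theorem proposition8 (R : realType) :
  (forall (n a b : nat) (F : path_family) (d : measure_display)
      (Omega : measurableType d) (P : probability Omega R)
      (X : nat -> Omega -> move n),
    (0 < n)%N -> (0 < a)%N -> (0 < b)%N ->
    wf_family a b n F -> paths_of a b n F != finset.set0 ->
    iid_moves P X ->
    P [set w | exists S : walk n, cftp_returns a b F (fun k => X k w) S] = 1%E
    /\ forall S : walk n,
         P [set w | cftp_returns a b F (fun k => X k w) S]
         = (if S \in paths_of a b n F then (#|paths_of a b n F|%:R)^-1
            else 0)%:E)
  /\
  (forall cdraw cupd : R, 0 < cdraw -> 0 < cupd ->
    exists K : R,
    forall (n a b : nat) (F : path_family) (d : measure_display)
      (Omega : measurableType d) (P : probability Omega R)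
      (X : nat -> Omega -> move n),
    (1 < n)%N -> (0 < a)%N -> (0 < b)%N ->
    wf_family a b n F -> paths_of a b n F != finset.set0 ->
    ~~ is_culminating F ->
    iid_moves P X ->
    (\int[P]_w cftp_time cdraw cupd a b F (fun k => X k w)
     <= (K * (n%:R ^+ 3 * ln n%:R ^+ 2))%:E)%E).
Proof.
split.
  move=> n a b F d Omega P X n0 ha hb hwf hA hX; split.
    exact: terminates_prob.
  by move=> S; apply: returns_prob.
move=> cdraw cupd c1 c2; pose c := 3 * cdraw + cupd.
have c0 : 0 <= c by rewrite /c; lra.
(* As ln n >= 1/2, the 2 is at most 8 n^3 (ln n)^2, and 256 n^3 ln n at most 512 n^3 (ln n)^2. *)
exists (c * (8 + 512)) => n a b F d Omega P X n1 ha hb hwf hA hF hX.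
apply: le_trans (cftp_time_le n1 ha hb hwf hA hF hX (ltW c1) (ltW c2)) _.
rewrite lee_fin -/c -mulrA; apply: ler_wpM2l => //.
have n1R : 1 <= n%:R :> R by rewrite ler1n ltnW.
have l12 : 1 / 2 <= ln n%:R :> R.
  by apply: le_trans (ln2_ge R) _; rewrite ler_ln ?posrE ?ltr0n ?ler_nat // ltnW.
have n3 : 1 <= n%:R ^+ 3 :> R by rewrite exprn_ege1.
have l2 : 1 / 4 <= ln n%:R ^+ 2 :> R.
  by have := ler_pM _ _ l12 l12; rewrite -expr2 => h; apply: le_trans (h _ _); lra.
have h1 : 1 / 4 <= n%:R ^+ 3 * ln n%:R ^+ 2 :> R.
  by apply: le_trans l2 _; rewrite ler_peMl // sqr_ge0.
have h2 : n%:R ^+ 3 * ln n%:R <= 2 * (n%:R ^+ 3 * ln n%:R ^+ 2) :> R.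
  rewrite mulrCA; apply: ler_wpM2l; first lra.
  by rewrite expr2 mulrA ler_peMl; lra.
lra.
Qed.
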